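(* Let $\Omega\subseteq\mathbb{R}^n$ be an open definable set and let $f\colon\Omega\to\mathbb{R}^n$ be a continuous definable mapping. Let $x\in\Omega$. Then there exists a dense and definable subset $\Omega(x)$ of $\Omega$ such that for each $x'\in\Omega(x)$ with $[x,x']\subset\Omega$ we have $$f(x')-f(x)\in\overline{\mathrm{co}}\,\{df[x,x'](x'-x)\},$$ where $df[x,x'](x'-x):=\{A(x'-x): A\in df([x,x'])\}$.
   Context: Fix an o-minimal structure on $(\mathbb{R},+,\cdot)$, i.e. a sequence $(\mathcal{D}_n)_{n\in\mathbb{N}}$ such that: (a) $\mathcal{D}_n$ is a Boolean algebra of subsets of $\mathbb{R}^n$; (b) $X\in\mathcal{D}_m$, $Y\in\mathcal{D}_n$ imply $X\times Y\in\mathcal{D}_{m+n}$; (c) if $X\in\mathcal{D}_{n+1}$ then $\pi(X)\in\mathcal{D}_n$, where $\pi\colon\mathbb{R}^{n+1}\to\mathbb{R}^n$ is the projection on the first $n$ coordinates; (d) $\mathcal{D}_n$ contains all algebraic subsets of $\mathbb{R}^n$; (e) each set in $\mathcal{D}_1$ is a finite union of points and intervals. A set is definable if it belongs to some $\mathcal{D}_n$; a mapping is definable if its graph is definable. $[x,x']:=\{(1-t)x+tx': 0\le t\le1\}$; $\overline{\mathrm{co}}$ denotes closed convex hull. $B_f$ is the set of points of $\Omega$ at which $f$ is not of class $C^1$ (i.e. $f$ is not $C^1$ on any neighbourhood of the point); it is a definable nowhere dense set. For $z\in\Omega\setminus B_f$, $df(z)\in\mathbb{R}^{n\times n}$ is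 the derivative of $f$ at $z$; for $U\subset\Omega$, $df(U):=\{df(z): z\in U\setminus B_f\}$. *)

(* Defs.v *)
(* Points of R^n are row vectors 'rV[R]_n; the identification
   R^m x R^n = R^(m+n) is given by [lsubmx] and [rsubmx]. *)
From HB Require Import structures.
From mathcomp Require Export all_boot all_order all_algebra.
From mathcomp Require Export all_classical all_reals all_analysis.
From mathcomp Require Export -(notations) mpoly.

Set Implicit Arguments.
Unset Strict Implicit.
Unset Printing Implicit Defensive.

Export Order.TTheory GRing.Theory Num.Theory.
Export numFieldNormedType.Exports.

Local Open Scope classical_set_scope.
Local Open Scope ring_scope.

Definition algebraic_set (R : realType) (n : nat) (X : set 'rV[R]_n) : Prop :=
  exists s : seq (mpoly n R),
    X = [set x : 'rV[R]_n | forall p : mpoly n R, p \in s -> meval (fun i => x 0 i) p = 0].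

(* [interval R] includes the unbounded intervals. *)
Definition finite_union_points_intervals (R : realType) (X : set R) : Prop :=
  exists (P : seq R) (I : seq (interval R)),
    X = [set t | t \in P \/ exists2 J, J \in I & t \in J].

Record o_minimal (R : realType) (D : forall n, set (set 'rV[R]_n)) : Prop := {
  omin_set0 : forall n, D n set0 ;
  omin_setT : forall n, D n setT ;
  omin_setU : forall n X Y, D n X -> D n Y -> D n (X `|` Y) ;
  omin_setI : forall n X Y, D n X -> D n Y -> D n (X `&` Y) ;
  omin_setC : forall n X, D n X -> D n (~` X) ;
  omin_prod : forall m n (X : set 'rV[R]_m) (Y : set 'rV[R]_n),
    D m X -> D n Y -> D (m + n)%N [set z | X (lsubmx z) /\ Y (rsubmx z)] ;
  omin_proj : forall n (X : set 'rV[R]_(n + 1)),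
    D (n + 1)%N X -> D n [set lsubmx z | z in X] ;
  omin_alg : forall n (X : set 'rV[R]_n), algebraic_set X -> D n X ;
  omin_dim1 : forall X : set 'rV[R]_1,
    D 1%N X -> finite_union_points_intervals [set x 0 0 | x in X]
}.

(* A mapping Omega -> R^m is a total function, only whose values on Omega
   matter. *)
Definition definable_map (R : realType) (D : forall n, set (set 'rV[R]_n))
    (n m : nat) (Omega : set 'rV[R]_n) (f : 'rV[R]_n -> 'rV[R]_m) : Prop :=
  D (n + m)%N [set z | Omega (lsubmx z) /\ rsubmx z = f (lsubmx z)].

Section Derivative.
Variables (R : realType) (n : nat).
Implicit Types (Omega U V : set 'rV[R]_n) (f : 'rV[R]_n -> 'rV[R]_n).

Definition C1_on V f : Prop :=
  (forall y, V y -> differentiable f y) /\ {within V, continuous (jacobian f)}.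

Definition non_C1 Omega f : set 'rV[R]_n :=
  [set z | Omega z /\
     ~ exists V, [/\ open_nbhs z V, V `<=` Omega & C1_on V f]].

(* The library's jacobian acts on row vectors, ['d f z v = v *m 'J f z]: it is
   the transpose of the usual matrix df(z), and A v becomes [v *m A]. *)
Definition df_set Omega f U : set 'M[R]_n :=
  [set 'J f z | z in U `\` non_C1 Omega f].

Definition segment (x x' : 'rV[R]_n) : set 'rV[R]_n :=
  [set (1 - t) *: x + t *: x' | t in [set t : R | 0 <= t <= 1]].

Definition closed_convex_hull (S : set 'rV[R]_n) : set 'rV[R]_n :=
  smallest (fun C : set 'rV[R]_n => closed C /\ convex_set C) S.

End Derivative.

(* Main.v *)
(* Call z singular if arbitrarily close to z some strict partial derivative of f
   fails to exist; away from singular points f is C^1.  Baire's theorem replaces cell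
   decomposition: by induction on the dimension, a definable set or its
   complement has interior in every open set, hence if countably many definable
   sets cover an open set, one of them contains an open set.  For a direction e
   and a real p, o-minimality fixes the sign of f_j(y + t e) - f_j(y) - p t for
   all small t > 0; on a smaller open set it is the same sign for all y and all
   t below a common bound.  Doing this for all rational p leaves, generically,
   one finite slope, i.e. a strict partial derivative: the singular set is
   nowhere dense.
   Omega(x) consists of the x' whose segment [x, x'] contains no subinterval of
   singular points.  It is dense: otherwise, by Baire, for one rational t > 0
   the points x + t (x' - x) would be singular for a somewhere dense set of x'.
   If f(x') - f(x) were outside the hull, a separating linear functional,
   composed with t |-> f(x + t (x' - x)), would contradict the scalar mean value
   inequality, where isolated singular points are harmless by continuity. *)
From HB Require Import structures.
From mathcomp Require Import ring lra.
Require Import Defs.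

Set Implicit Arguments.
Unset Strict Implicit.
Unset Printing Implicit Defensive.

Local Open Scope classical_set_scope.
Local Open Scope ring_scope.
Import VectorInternalTheory.

(* Makes ['M[R]_(m, n)] a [completeNormedModType], as required by [Baire]. *)
HB.instance Definition _ (R : realType) (m n : nat) := PseudoMetric.on 'M[R]_(m, n).

(** * The maximum norm on row vectors, and Baire's theorem for countable covers *)

Section RowNorm.
Variable R : realType.

(** The norm is a maximum over the coordinates and 0; [0 < d] is stated separately because for
    [n = 0] there are no coordinates. *)
Lemma rV_norm_ltP n (v : 'rV[R]_n) (d : R) :
  `|v| < d <-> 0 < d /\ forall i, `|v 0 i| < d.
Proof.
rewrite [`|_|]mx_normrE; split=> [h|[d0 h]].
  split=> [|i]; first by apply: le_lt_trans h; exact: bigmax_ge_id.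
  apply: le_lt_trans h.
  exact: (le_bigmax _ (fun ij : 'I_1 * 'I_n => `|v ij.1 ij.2|) (0, i)).
by rewrite bigmax_lt //= => -[i j] _ /=; rewrite ord1.
Qed.

Lemma le_rV_norm n (v : 'rV[R]_n) i : `|v 0 i| <= `|v|.
Proof.
rewrite [leRHS]mx_normrE.
exact: (le_bigmax _ (fun ij : 'I_1 * 'I_n => `|v ij.1 ij.2|) (0, i)).
Qed.

Lemma rV_norm_leP n (v : 'rV[R]_n) (d : R) :
  `|v| <= d <-> 0 <= d /\ forall i, `|v 0 i| <= d.
Proof.
split=> [h|[d0 h]].
  by split=> [|i]; [exact: le_trans h|exact: le_trans (le_rV_norm _ _) h].
apply/ler_addgt0Pr => e e0; apply/ltW/rV_norm_ltP; split=> [|i]; first by lra.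
by apply: le_lt_trans (h i) _; lra.
Qed.

Lemma open_normP n (W : set 'rV[R]_n) (w : 'rV[R]_n) : open W -> W w ->
  exists2 r : R, 0 < r & forall z, `|w - z| < r -> W z.
Proof.
move=> oW Ww; have : nbhs w W by exact: open_nbhs_nbhs.
move=> /nbhs_ballP[r /= r0 rW]; exists r => // z wz; apply: rW.
by rewrite -ball_normE.
Qed.

Lemma open_norm_ball n (w : 'rV[R]_n) (r : R) : open [set z | `|w - z| < r].
Proof.
have -> : [set z | `|w - z| < r] = ball w r by rewrite -ball_normE.
exact: ball_open.
Qed.

(** If no [A i] were dense in an open part of [W], the complements of the closures of the traces of
    the [A i] on [W] would be open and dense, and by Baire some point of [W] would lie in no
    [A i]. *)
Lemma baire_cover n (I : countType) (A : I -> set 'rV[R]_n) (W : set 'rV[R]_n) :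
  open W -> W !=set0 -> W `<=` \bigcup_i A i ->
  exists i O, [/\ open O, O !=set0, O `<=` W &
    forall V, open V -> V !=set0 -> V `<=` O -> V `&` A i !=set0].
Proof.
move=> oW [w Ww] WA; apply: contrapT => nA.
have hA i O : open O -> O !=set0 -> O `<=` W ->
    exists V, [/\ open V, V !=set0, V `<=` O & V `&` A i = set0].
  move=> oO O0 OW; apply: contrapT => nV; apply: nA; exists i, O; split=> // V oV V0 VO.
  apply: contrapT => nVA; apply: nV; exists V; split=> //.
  by apply: contrapT => /eqP/set0P.
(* Reindexes the family by the naturals; numbers that code no index get the empty set. *)
pose A' k := if unpickle k is Some i then A i else set0.
pose F k := ~` closure (W `&` A' k).
have Fdense k : open (F k) /\ dense (F k).
  split; first exact/closed_openC/closed_closure.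
  move=> O O0 oO.
  have key V : open V -> V !=set0 -> V `<=` O -> V `&` (W `&` A' k) = set0 ->
      O `&` F k !=set0.
    move=> oV [v Vv] VO V0; exists v; split; first exact: VO.
    move=> /(_ V (open_nbhs_nbhs (conj oV Vv))) [z [[Wz Az] Vz]].
    by have : (V `&` (W `&` A' k)) z by []; rewrite V0.
  have [OW0|/set0P OW] := eqVneq (O `&` W) set0.
    by apply: (key O) => //; rewrite setIA OW0 set0I.
  have [V0 [oV V00 VOW VA]] : exists V,
      [/\ open V, V !=set0, V `<=` O `&` W & V `&` A' k = set0].
    rewrite /A'; case: (unpickle k) => [i|].
      have [V [oV V0 VOW VA]] := hA i _ (openI oO oW) OW (@subIsetr _ _ _).
      by exists V.
    by exists (O `&` W); rewrite setI0; split=> //; exact: openI.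
  apply: (key V0) => //; first by move=> z /VOW[].
  by apply/seteqP; split=> // z [Vz [_ Az]]; rewrite -VA; split.
have /(_ W (ex_intro _ w Ww) oW)[z [Wz Fz]] := Baire Fdense.
have [i _ Az] := WA _ Wz.
have /= := Fz (pickle i) Logic.I; apply.
by apply: subset_closure; split=> //; rewrite /A' pickleK.
Qed.

End RowNorm.

(** * Definable sets and first-order formulas *)

Section Definability.
Variables (R : realType) (D : forall n, set (set 'rV[R]_n)).
Arguments D : clear implicits.
Hypothesis hD : o_minimal D.

Lemma definable_kernel k l (M : 'M[R]_(k, l)) (c : 'rV[R]_l) :
  D k [set z | z *m M = c].
Proof.
apply: (omin_alg hD).
pose p (j : 'I_l) : mpoly.mpoly k R :=
  \sum_i M i j *: mpoly.mpolyX R (mpoly.mnm1 i) - mpoly.mpolyC k (c 0 j).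
have pE (z : 'rV[R]_k) j : mpoly.meval (fun i => z 0 i) (p j) = (z *m M - c) 0 j.
  rewrite /p mpoly.mevalB mpoly.mevalC raddf_sum /= !mxE; congr (_ - _).
  by apply: eq_bigr => i _; rewrite mpoly.mevalZ mpoly.mevalXU mulrC.
exists [seq p j | j : 'I_l]; apply/seteqP; split=> z /=.
  by move=> zc q /mapP[j _ ->]; rewrite pE zc subrr mxE.
move=> h; apply/rowP => j; apply/eqP; rewrite -subr_eq0; apply/eqP.
by have := h (p j); rewrite pE !mxE; apply; apply: map_f; rewrite mem_enum.
Qed.

Lemma definable_cast k l (e : k = l) (Z : set 'rV[R]_k) :
  D k Z -> D l [set castmx (erefl, e) z | z in Z].
Proof.
case: l / e => DZ; rewrite (_ : [set _ | _ in _] = Z)//.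
by apply/seteqP; split=> z /=; [case=> w ? <-|move=> ?; exists z => //];
  rewrite castmx_id.
Qed.

Lemma definable_proj n m (Z : set 'rV[R]_(n + m)) :
  D (n + m)%N Z -> D n [set lsubmx z | z in Z].
Proof.
elim: m Z => [|m IH] Z DZ.
  have := definable_cast (addn0 n) DZ; congr D; apply/seteqP.
  have E (z : 'rV[R]_(n + 0)) : castmx (erefl, addn0 n) z = lsubmx z.
    by apply/rowP => i; rewrite castmxE !mxE; congr (z _ _); apply/val_inj.
  by split=> z /= -[w Zw <-]; exists w => //; rewrite E.
have e : (n + m.+1 = n + m + 1)%N by rewrite addn1 addnS.
have := IH _ (omin_proj hD (definable_cast e DZ)); congr D; apply/seteqP.
have E (z : 'rV[R]_(n + m.+1)) : lsubmx (lsubmx (castmx (erefl, e) z)) = lsubmx z.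
  by apply/rowP => i; rewrite !mxE castmxE; congr (z _ _); apply/val_inj.
split=> z /=.
  by move=> [_ [_ [w Zw <-] <-] <-]; exists w => //; rewrite E.
move=> [w Zw <-]; exists (lsubmx (castmx (erefl, e) w)); last exact: E.
by exists (castmx (erefl, e) w) => //; exists w.
Qed.

(** The graph of the affine map is an affine subspace, hence definable; the preimage is the
    projection of its intersection with [R^n x X]. *)
Lemma definable_preimage m n (X : set 'rV[R]_m) (M : 'M[R]_(n, m)) (c : 'rV[R]_m) :
  D m X -> D n [set x | X (x *m M + c)].
Proof.
move=> DX.
have := definable_proj (omin_setI hD (omin_prod hD (omin_setT hD n) DX)
  (definable_kernel (col_mx (- M) 1%:M) c)); congr D; apply/seteqP.
have E (z : 'rV[R]_(n + m)) :
    z *m col_mx (- M) 1%:M = c -> rsubmx z = lsubmx z *m M + c.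
  by rewrite -{1}[z]hsubmxK mul_row_col mulmx1 mulmxN => <-; rewrite addrA subrr add0r.
split=> x /=; first by move=> [z [[_ Xz] /E zc] <-]; rewrite -zc.
move=> Xx; exists (row_mx x (x *m M + c)); rewrite ?row_mxKl ?row_mxKr//=.
split; first by split.
by rewrite mul_row_col mulmx1 mulmxN addrA addNr add0r.
Qed.

(* [g - g 0] is linear, written without subtraction. *)
Definition affine_map (T S : vectType R) (g : T -> S) :=
  forall a u v, g (a *: u + v) + a *: g 0 = a *: g u + g v.

(* Predicates in several vector and scalar variables are predicates on a product
   of [vectType]s; a scalar variable has type [R^o], as [R] is not a [vectType]. *)
Definition definable (T : vectType R) (P : T -> Prop) :=
  D (dim T) [set x | P (r2v x)].

(** * Affine maps, which serve as the terms of formulas *)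

Section affine_maps.
Variables (T : vectType R).

Lemma affine_id : affine_map (fun x : T => x).
Proof. by move=> a u v; rewrite scaler0 addr0. Qed.

Lemma affine_cst (S : vectType R) (c : S) : affine_map (fun _ : T => c).
Proof. by move=> a u v; rewrite addrC. Qed.

Lemma affine_linear (S : vectType R) (h : {linear T -> S}) : affine_map h.
Proof. by move=> a u v; rewrite linear0 scaler0 addr0 linearP. Qed.

Lemma affine_fst (S1 S2 : vectType R) (g : T -> (S1 * S2)%type) :
  affine_map g -> affine_map (fun x => (g x).1).
Proof. by move=> lg a u v; have /(congr1 fst) := lg a u v. Qed.

Lemma affine_snd (S1 S2 : vectType R) (g : T -> (S1 * S2)%type) :
  affine_map g -> affine_map (fun x => (g x).2).
Proof. by move=> lg a u v; have /(congr1 snd) := lg a u v. Qed.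

Lemma affine_pair (S1 S2 : vectType R) (g1 : T -> S1) (g2 : T -> S2) :
  affine_map g1 -> affine_map g2 ->
  affine_map (fun x => (g1 x, g2 x) : (S1 * S2)%type).
Proof. by move=> l1 l2 a u v; congr pair; [apply: l1 | apply: l2]. Qed.

Lemma affine_add (S : vectType R) (g1 g2 : T -> S) :
  affine_map g1 -> affine_map g2 -> affine_map (fun x => g1 x + g2 x).
Proof. by move=> l1 l2 a u v; rewrite !scalerDr addrACA l1 l2 addrACA. Qed.

Lemma affine_opp (S : vectType R) (g : T -> S) :
  affine_map g -> affine_map (fun x => - g x).
Proof. by move=> lg a u v; rewrite !scalerN -!opprD lg. Qed.

Lemma affine_scalel (S : vectType R) (b : S) (g : T -> R^o) :
  affine_map g -> affine_map (fun x => (g x : R) *: b).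
Proof.
move=> lg a u v; rewrite !scalerA -!scalerDl; congr (_ *: b).
exact: lg.
Qed.

Lemma affine_coord m n (g : T -> 'M[R]_(m, n)) i j :
  affine_map g -> affine_map (fun x => g x i j : R^o).
Proof.
move=> lg a u v.
by have /(congr1 (fun M : 'M[R]_(m, n) => M i j)) := lg a u v; rewrite !mxE.
Qed.

Lemma affine_row_mx m n1 n2 (g1 : T -> 'M[R]_(m, n1)) (g2 : T -> 'M[R]_(m, n2)) :
  affine_map g1 -> affine_map g2 -> affine_map (fun x => row_mx (g1 x) (g2 x)).
Proof. by move=> l1 l2 a u v; rewrite !scale_row_mx !add_row_mx l1 l2. Qed.

Lemma affine_const_mx m n (g : T -> R^o) :
  affine_map g -> affine_map (fun x => const_mx (g x) : 'M[R]_(m, n)).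
Proof.
by move=> lg a u v; have E := lg a u v; apply/matrixP => i j; rewrite !mxE.
Qed.

End affine_maps.

Lemma affine_matrix n m (g : 'rV[R]_n -> 'rV[R]_m) : affine_map g ->
  exists M : 'M[R]_(n, m), exists c, forall x, g x = x *m M + c.
Proof.
move=> lg; have lh : linear (fun x => g x - g 0).
  move=> a u v; apply: (addIr (a *: g 0)).
  by rewrite addrAC lg scalerBr [RHS]addrAC subrK addrA.
pose h : {linear 'rV[R]_n -> 'rV[R]_m} :=
  HB.pack (fun x => g x - g 0) (GRing.isLinear.Build R _ _ _ _ lh).
by exists (lin1_mx h), (g 0) => x; rewrite mul_rV_lin1 /= subrK.
Qed.

Lemma affine_map_comp (T S U : vectType R) (g : T -> S) (h : S -> U) :
  affine_map g -> affine_map h -> affine_map (fun x => h (g x)).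
Proof.
by move=> lg lh a u v; rewrite -lh -lg [LHS]addrC -lh (addrC (a *: g 0)).
Qed.

Lemma definable_comp (T S : vectType R) (g : T -> S) (P : S -> Prop) :
  affine_map g -> definable P -> definable (fun x => P (g x)).
Proof.
move=> lg dP.
have : affine_map (fun x => v2r (g (r2v x))).
  exact: affine_map_comp (affine_map_comp (affine_linear r2v) lg) (affine_linear v2r).
move=> /affine_matrix[M [c E]].
have := definable_preimage M c dP; congr D; apply/seteqP.
by split=> x /=; rewrite -E v2rK.
Qed.

(** ['rV[R]_n] and its coordinate space ['rV_(dim 'rV[R]_n)] are different types; [v2r] and [r2v]
    are linear, so definability passes between them by affine preimage. *)
Lemma definable_rV n (X : set 'rV[R]_n) : D n X <-> definable X.
Proof.
split=> [dX|/definable_comp dX].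
  have /affine_matrix[M [c E]] : affine_map (r2v : 'rV_(dim 'rV[R]_n) -> 'rV[R]_n).
    exact: affine_linear.
  have := definable_preimage M c dX; congr D; apply/seteqP.
  by split=> x /=; rewrite -E.
have /affine_matrix[M [c E]] : affine_map (v2r : 'rV[R]_n -> 'rV_(dim 'rV[R]_n)).
  exact: affine_linear.
have := definable_preimage M c (dX _ id (@affine_id _)); congr D; apply/seteqP.
by split=> x /=; rewrite -E v2rK.
Qed.

(** * Closure of definable predicates under connectives and quantifiers *)

Section connectives.
Variables (T : vectType R).
Implicit Types P Q : T -> Prop.

Lemma definable_ext P Q : (forall x, P x <-> Q x) -> definable P -> definable Q.
Proof. by move=> PQ; congr D; apply/seteqP; split=> x /PQ. Qed.

Lemma definable_and P Q :
  definable P -> definable Q -> definable (fun x => P x /\ Q x).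
Proof. exact: omin_setI. Qed.

Lemma definable_or P Q :
  definable P -> definable Q -> definable (fun x => P x \/ Q x).
Proof. exact: omin_setU. Qed.

Lemma definable_not P : definable P -> definable (fun x => ~ P x).
Proof. exact: omin_setC. Qed.

Lemma definable_true : definable (fun _ : T => True).
Proof. exact: omin_setT. Qed.

Lemma definable_imply P Q :
  definable P -> definable Q -> definable (fun x => P x -> Q x).
Proof.
move=> dP dQ; apply: definable_ext (definable_or (definable_not dP) dQ) => x.
by split=> [[]//|PQ]; have [/PQ|] := pselect (P x); [right | left].
Qed.

End connectives.

Section quantifiers.
Variables (T : vectType R).

(** An existential quantifier is a projection; [g] splits the coordinates of [R^(dim T + dim S)]
    into those of the pair. *)
Lemma definable_ex (S : vectType R) (P : T -> S -> Prop) :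
  definable (fun p : T * S => P p.1 p.2) -> definable (fun x => exists y, P x y).
Proof.
move=> dP.
pose g (z : 'rV[R]_(dim T + dim S)) : (T * S)%type := (r2v (lsubmx z), r2v (rsubmx z)).
have lg : affine_map g.
  by apply: affine_pair; apply: affine_map_comp (affine_linear _) (affine_linear r2v).
have /(proj2 (definable_rV _))/definable_proj := definable_comp lg dP.
congr D; apply/seteqP; split=> x /=.
  by move=> [z Pz <-]; exists (r2v (rsubmx z)).
by move=> [y Py]; exists (row_mx x (v2r y)); rewrite ?row_mxKl //= row_mxKr v2rK.
Qed.

Lemma definable_all (S : vectType R) (P : T -> S -> Prop) :
  definable (fun p : T * S => P p.1 p.2) -> definable (fun x => forall y, P x y).
Proof.
move=> dP.
have dQ := @definable_ex S (fun x y => ~ P x y) (definable_not dP).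
apply: definable_ext (definable_not dQ) => x; split=> [h y|h [y nP]]; last exact: nP.
by apply: contrapT => nP; apply: h; exists y.
Qed.

Lemma definable_all_fin (I : finType) (P : I -> T -> Prop) :
  (forall i, definable (P i)) -> definable (fun x => forall i, P i x).
Proof.
move=> dP.
have : definable (fun x => forall i, i \in enum I -> P i x).
  elim: (enum I) => [|i s IH].
    by apply: definable_ext (@definable_true T) => x.
  apply: definable_ext (definable_and (dP i) IH) => x; split.
    by move=> [Pi Ps] j; rewrite in_cons => /orP[/eqP->//|/Ps].
  move=> h; split=> [|j js]; apply: h; rewrite in_cons ?eqxx//.
  by rewrite js orbT.
by apply: definable_ext => x; split=> h i => [|_]; apply: h; rewrite mem_enum.
Qed.

Lemma definable_eq (S : vectType R) (f g : T -> S) :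
  affine_map f -> affine_map g -> definable (fun x => f x = g x).
Proof.
move=> lf lg; have d0 : definable (fun y : S => y = 0).
  have := definable_kernel 1%:M (0 : 'rV[R]_(dim S)); congr D; apply/seteqP.
  split=> x /=; rewrite mulmx1; first by move->; rewrite linear0.
  by move=> /(congr1 v2r); rewrite r2vK linear0.
have := definable_comp (affine_add lf (affine_opp lg)) d0.
by apply: definable_ext => x; split=> [/subr0_eq//|->]; rewrite subrr.
Qed.

(** The basic nonlinear atom: its surface in [R^3] is algebraic. It is a relation because terms are
    affine; a product inside a formula is named by a quantified variable. *)
Lemma definable_mul (a b c : T -> R^o) :
  affine_map a -> affine_map b -> affine_map c ->
  definable (fun x => c x = (a x : R) * (b x : R)).
Proof.
move=> la lb lc.
have : definable (fun z : 'rV[R]_3 => z 0 2%:R = z 0 0 * z 0 1).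
  apply: (proj1 (definable_rV _)); apply: (omin_alg hD).
  exists [:: mpoly.mpolyX R (mpoly.mnm1 2%:R) -
    mpoly.mpolyX R (mpoly.mnm1 0) * mpoly.mpolyX R (mpoly.mnm1 1)].
  apply/seteqP; split=> z /=.
    move=> E p; rewrite inE => /eqP->.
    by rewrite mpoly.mevalB mpoly.mevalM !mpoly.mevalXU E subrr.
  move=> /(_ _ (mem_head _ _)).
  by rewrite mpoly.mevalB mpoly.mevalM !mpoly.mevalXU => /subr0_eq.
pose e (i : 'I_3) : 'rV[R]_3 := delta_mx 0 i.
have lg : affine_map (fun x => (a x : R) *: e 0 + (b x : R) *: e 1 + (c x : R) *: e 2%:R).
  by do 2?apply: affine_add; apply: affine_scalel.
move=> /(definable_comp lg); apply: definable_ext => x.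
by rewrite !mxE /= ?(mulr0, mulr1, addr0, add0r).
Qed.

End quantifiers.

(** * Order and norm inequalities as formulas *)

Section formulas_order.
Variables (T : vectType R).

(** The nonnegative reals are the squares, so the order is the projection of an algebraic
    relation. *)
Lemma definable_ge0 (f : T -> R^o) :
  affine_map f -> definable (fun x => 0 <= (f x : R)).
Proof.
move=> lf.
have : definable (fun x => exists y : R^o, f x = (y : R) * (y : R)).
  apply: definable_ex; apply: definable_mul; try exact: affine_snd (@affine_id _).
  exact: (affine_map_comp (affine_fst (@affine_id _)) lf).
apply: definable_ext => x; split=> [[y ->]|fx]; first by rewrite -expr2 sqr_ge0.
by exists (Num.sqrt (f x : R)); rewrite -expr2 sqr_sqrtr.
Qed.

Lemma definable_le (f g : T -> R^o) : affine_map f -> affine_map g ->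
  definable (fun x => (f x : R) <= (g x : R)).
Proof.
move=> lf lg; apply: definable_ext (definable_ge0 (affine_add lg (affine_opp lf))).
by move=> x; rewrite subr_ge0.
Qed.

Lemma definable_lt (f g : T -> R^o) : affine_map f -> affine_map g ->
  definable (fun x => (f x : R) < (g x : R)).
Proof.
move=> lf lg; apply: definable_ext (definable_not (definable_le lg lf)) => x.
by rewrite ltNge; split=> /negP.
Qed.

Lemma definable_norm_lt n (f : T -> 'rV[R]_n) (g : T -> R^o) :
  affine_map f -> affine_map g -> definable (fun x => `|f x| < (g x : R)).
Proof.
move=> lf lg.
have : definable (fun x => 0 < (g x : R) /\
    forall i, (- (g x : R) < f x 0 i /\ f x 0 i < (g x : R))).
  apply: definable_and; first exact: definable_lt (affine_cst _) lg.
  apply: definable_all_fin => i.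
  apply: definable_and; apply: definable_lt => //; try exact: affine_coord.
  exact: affine_opp.
apply: definable_ext => x; split=> [[g0 h]|/rV_norm_ltP[g0 h]].
  by apply/rV_norm_ltP; split=> // i; rewrite ltr_norml; apply/andP.
by split=> // i; apply/andP; rewrite -ltr_norml.
Qed.

End formulas_order.
End Definability.

Ltac affine := repeat match goal with
  | |- affine_map (fun x => x) => apply: affine_id
  | |- affine_map (fun _ => ?c) => apply: affine_cst
  | |- affine_map fst => apply: (affine_linear fst)
  | |- affine_map snd => apply: (affine_linear snd)
  | |- affine_map (@const_mx _ ?m ?n) => exact: (affine_const_mx m n (@affine_id _ _))
  | |- affine_map (fun x => fst (@?g x)) => apply: affine_fst
  | |- affine_map (fun x => snd (@?g x)) => apply: affine_snd
  | |- affine_map (fun x => pair (@?g x) (@?h x)) => apply: affine_pair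
  | |- affine_map (fun x => (@?g x + @?h x)%R) => apply: affine_add
  | |- affine_map (fun x => (- @?g x)%R) => apply: affine_opp
  | |- affine_map (fun x => row_mx (@?g x) (@?h x)) => apply: affine_row_mx
  | |- affine_map (fun x => const_mx (@?g x)) => apply: affine_const_mx
  | |- affine_map (fun x => fun_of_matrix (@?g x) ?i ?j) => apply: affine_coord
  | |- affine_map (fun x => (@?g x *: ?b)%R) => apply: affine_scalel
  end.

(** * One-sided germs of subsets of the line *)

Section Germs.
Variable R : realType.

(** The truth value of [X] is constant just to the right of [c]. Such [X] form a Boolean algebra
    containing the half-lines, hence all points and intervals; this is the form in which [omin_dim1]
    is used. *)
Definition right_germ (X : R -> Prop) (c : R) := exists2 d : R, c < d &
  (forall t, c < t < d -> X t) \/ (forall t, c < t < d -> ~ X t).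

Lemma right_germ_ext (X Y : R -> Prop) c : (forall t, X t <-> Y t) ->
  right_germ X c -> right_germ Y c.
Proof.
move=> XY [d cd H]; exists d => //; case: H => H; [left|right] => t /H.
  by move=> /XY.
by move=> h /XY.
Qed.

Lemma right_germ_and (X Y : R -> Prop) c : right_germ X c -> right_germ Y c ->
  right_germ (fun t => X t /\ Y t) c.
Proof.
move=> [d cd Xd] [e ce Ye]; exists (Num.min d e); first by rewrite lt_min cd.
case: Xd => Xd; last first.
  right=> t /andP[ct]; rewrite lt_min => /andP[td te] [].
  by have := Xd t; rewrite ct td => /(_ isT).
case: Ye => Ye; last first.
  right=> t /andP[ct]; rewrite lt_min => /andP[td te] [] _.
  by have := Ye t; rewrite ct te => /(_ isT).
left=> t /andP[ct]; rewrite lt_min => /andP[td te].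
by split; [apply: Xd | apply: Ye]; rewrite ct.
Qed.

Lemma right_germ_not (X : R -> Prop) c : right_germ X c -> right_germ (fun t => ~ X t) c.
Proof.
move=> [d cd Xd]; exists d => //; case: Xd => Xd; last by left.
by right=> t /Xd Xt; apply.
Qed.

Lemma right_germ_or (X Y : R -> Prop) c : right_germ X c -> right_germ Y c ->
  right_germ (fun t => X t \/ Y t) c.
Proof.
move=> hX hY.
have := right_germ_not (right_germ_and (right_germ_not hX) (right_germ_not hY)).
apply: right_germ_ext.
by move=> t; rewrite not_andE !notK.
Qed.

Lemma right_germ_ge (x c : R) : right_germ (fun t => x <= t) c.
Proof.
have [xc|cx] := leP x c.
  by exists (c + 1); [lra|left=> t; lra].
by exists x => //; right=> t; lra.
Qed.

Lemma right_germ_le (x c : R) : right_germ (fun t => t <= x) c.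
Proof.
have [xc|cx] := leP x c.
  by exists (c + 1); [lra|right=> t; lra].
by exists x => //; left=> t; lra.
Qed.

Lemma right_germ_itv (J : interval R) c : right_germ (fun t => t \in J) c.
Proof.
have lt_germ x : right_germ (fun t => t < x) c.
  apply: right_germ_ext (right_germ_not (right_germ_ge x c)) => t.
  by rewrite ltNge; split=> /negP.
have gt_germ x : right_germ (fun t => x < t) c.
  apply: right_germ_ext (right_germ_not (right_germ_le x c)) => t.
  by rewrite ltNge; split=> /negP.
case: J => l u.
apply: (@right_germ_ext (fun t => (l <= BLeft t)%O /\ (BRight t <= u)%O)).
  by move=> t; rewrite inE /=; split=> /andP.
apply: right_germ_and.
  (* A lower bound is closed, open, minus infinity or plus infinity; the last gives the empty
     interval. *)
  case: l => [[] x|[]].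
  - exact: right_germ_ge.
  - exact: gt_germ.
  - by exists (c + 1); [lra|left].
  - by exists (c + 1); [lra|right].
case: u => [[] x|[]].
- exact: lt_germ.
- exact: right_germ_le.
- by exists (c + 1); [lra|right].
- by exists (c + 1); [lra|left].
Qed.

Lemma finite_union_right_germ (X : set R) c :
  finite_union_points_intervals X -> right_germ X c.
Proof.
move=> [P [I ->]] /=; apply: right_germ_or.
  elim: P => [|p P IH]; first by exists (c + 1); [lra|right].
  have gp := right_germ_and (right_germ_le p c) (right_germ_ge p c).
  apply: right_germ_ext (right_germ_or gp IH) => t.
  rewrite in_cons; split=> [[/andP|->]|/orP[/eqP->|]]; rewrite ?orbT//; last by right.
    by rewrite -eq_le => /eqP->; rewrite eqxx.
  by left; rewrite lexx.
elim: I => [|J I IH].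
  by exists (c + 1); [lra|right=> t _ []].
apply: right_germ_ext (right_germ_or (right_germ_itv J c) IH) => t.
split=> [[tJ|[J' J'I tJ']]|[J']].
- by exists J => //; rewrite mem_head.
- by exists J' => //; rewrite in_cons J'I orbT.
- rewrite in_cons => /orP[/eqP->|J'I tJ']; first by left.
  by right; exists J'.
Qed.

End Germs.

(** * Interior of a definable set or of its complement in every open set *)

Section Dichotomy.
Variables (R : realType) (D : forall n, set (set 'rV[R]_n)).
Arguments D : clear implicits.
Hypothesis hD : o_minimal D.

Lemma definable_right_germ (P : R^o -> Prop) c : definable D P -> right_germ P c.
Proof.
move=> dP; apply: (@right_germ_ext _ [set x 0 0 | x in [set x : 'rV[R]_1 | P (x 0 0)]]).
  by move=> t; split=> [[x Px <-]//|Pt]; exists (const_mx t); rewrite /= mxE.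
apply/finite_union_right_germ/(omin_dim1 hD); apply/(proj2 (definable_rV hD _)).
by apply: (definable_comp hD) dP; apply: affine_coord; apply: affine_id.
Qed.

Definition dichotomy n := forall A W : set 'rV[R]_n, D n A -> open W -> W !=set0 ->
  exists V, [/\ open V, V !=set0, V `<=` W & V `<=` A \/ V `<=` ~` A].

(** Baire makes one [A i] dense in an open [O]; the dichotomy for [A i] in [O] then cannot yield an
    open set missing [A i], so it yields one inside [A i]. *)
Lemma dichotomy_cover n (I : countType) (A : I -> set 'rV[R]_n) (W : set 'rV[R]_n) :
  dichotomy n -> (forall i, D n (A i)) -> open W -> W !=set0 ->
  W `<=` \bigcup_i A i -> exists i V, [/\ open V, V !=set0, V `<=` W & V `<=` A i].
Proof.
move=> dn dA oW W0 WA; have [i [U [oO O0 OW OA]]] := baire_cover oW W0 WA.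
have [V [oV V0 VO [VA|VA]]] := dn _ _ (dA i) oO O0.
  by exists i, V; split=> // z /VO /OW.
by have [z [/VA]] := OA V oV V0 VO.
Qed.

(* The fibres of A are compared right of the last coordinate c of w: each of them
   contains or avoids some interval ]c, c + 1/(k+1)[. *)
Lemma dichotomy_succ n : dichotomy n -> dichotomy (n + 1).
Proof.
move=> IH A W dA oW [w Ww].
have [r r0 rW] := open_normP oW Ww.
pose c := w 0 (rshift n 0).
pose W1 := [set y | `|lsubmx w - y| < r].
pose S (b : bool) (y : 'rV[R]_n) (t : R^o) :=
  if b then A (row_mx y (const_mx t)) else ~ A (row_mx y (const_mx t)).
pose C (kb : nat * bool) := [set y : 'rV[R]_n | forall t : R^o,
  c < (t : R) < c + kb.1.+1%:R^-1 -> S kb.2 y t].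
have lrow : affine_map (fun p : 'rV[R]_n * R^o => row_mx p.1 (const_mx p.2 : 'rV[R]_1)).
  by affine.
have dA' := definable_comp hD lrow (proj1 (definable_rV hD _) dA).
have dC kb : D n (C kb).
  apply/(proj2 (definable_rV hD _)); apply: (definable_all hD).
  apply: (definable_imply hD).
    apply: (definable_ext (P := fun p => c < (p.2 : R) /\ (p.2 : R) < c + kb.1.+1%:R^-1)).
      by move=> p; split=> /andP.
    by apply: (definable_and hD); apply: (definable_lt hD); affine.
  rewrite /S; case: kb.2 => //.
  exact: (definable_not hD).
have W1C : W1 `<=` \bigcup_kb C kb.
  move=> y _.
  have : right_germ (fun t => A (row_mx y (const_mx t))) c.
    apply: definable_right_germ.
    by apply: (definable_comp hD) (proj1 (definable_rV hD _) dA); affine.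
  move=> [d cd H].
  have [k /ltW kd] : exists k, k.+1%:R^-1 < d - c :> R.
    have : 0 < d - c by lra.
    by move=> /ltr_add_invr[k]; rewrite add0r; exists k.
  case: H => H; [exists (k, true)|exists (k, false)] => // t /andP[ct /= td]; apply: H;
    by rewrite ct /= (lt_le_trans td)// -lerBrDl.
have W10 : W1 !=set0 by exists (lsubmx w); rewrite /W1 /= subrr normr0.
have [[k b] [V [oV [v Vv] VW VC]]] :=
  dichotomy_cover IH dC (@open_norm_ball _ _ _ _) W10 W1C.
have [e e0 eV] := open_normP oV Vv.
(* Half of the minimum: the last coordinate will run through []c, c + 2 * h[], which lies in the
   uniform fibre interval and within [r] of [c]. *)
pose h := Num.min (k.+1%:R^-1) r / 2.
have h0 : 0 < h by rewrite divr_gt0 // lt_min r0 invr_gt0 ltr0n.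
have hk : 2 * h <= k.+1%:R^-1 by rewrite /h mulrC divfK // ge_min lexx.
have hr : 2 * h <= r by rewrite /h mulrC divfK // ge_min lexx orbT.
pose z0 := row_mx v (const_mx (c + h)) : 'rV[R]_(n + 1).
pose O := [set z | `|z0 - z| < Num.min e h].
have OE z : O z -> [/\ V (lsubmx z), c < z 0 (rshift n 0) < c + 2 * h &
    z = row_mx (lsubmx z) (const_mx (z 0 (rshift n 0)))].
  move=> /rV_norm_ltP[_ Oz]; split.
  - apply: eV; apply/rV_norm_ltP; split=> // i.
    rewrite !mxE; have := Oz (lshift 1 i).
    by rewrite mxE row_mxEl [X in _ + X]mxE lt_min => /andP[].
  - have := Oz (rshift n 0); rewrite mxE row_mxEr mxE [X in _ + X]mxE lt_min => /andP[_].
    by rewrite ltr_norml; lra.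
  - by rewrite -[LHS]hsubmxK; congr row_mx; apply/rowP => i; rewrite ord1 !mxE.
exists O; split.
- exact: open_norm_ball.
- by exists z0; rewrite /O /= subrr normr0 lt_min e0.
- move=> z Oz; have [Vz zc zE] := OE z Oz.
  apply: rW; apply/rV_norm_ltP; split=> // i; rewrite !mxE.
  rewrite -[i]fintype.splitK; case: (fintype.split i) => j /=.
    by have /rV_norm_ltP[_ /(_ j)] := VW _ Vz; rewrite !mxE.
  by rewrite ord1 ltr_norml -/c; lra.
- case: b VC => VC; [left|right] => z Oz; have [Vz zc ->] := OE z Oz;
    apply: (VC _ Vz (z 0 (rshift n 0)));
    by case/andP: zc => -> /lt_le_trans; apply; rewrite lerD2l.
Qed.

Lemma definable_dichotomy n : dichotomy n.
Proof.
elim: n => [|n /dichotomy_succ]; last by rewrite addn1.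
move=> A W dA oW [w Ww].
(* [R^0] is one point, so [W] itself lies in [A] or in its complement. *)
exists W; split=> //; first by exists w.
have [Aw|nAw] := pselect (A w); [left|right] => z _;
  by rewrite (_ : z = w)//; apply/rowP => -[].
Qed.

Lemma definable_cover n (I : countType) (A : I -> set 'rV[R]_n) (W : set 'rV[R]_n) :
  (forall i, D n (A i)) -> open W -> W !=set0 ->
  W `<=` \bigcup_i A i -> exists i V, [/\ open V, V !=set0, V `<=` W & V `<=` A i].
Proof. exact: dichotomy_cover (@definable_dichotomy n). Qed.

End Dichotomy.

(** * Inequalities between endpoint values by real induction *)

Section RealInduction.
Variable R : realType.

(** Take the supremum of the [u] with [phi a <= phi u]: [left_step] puts it in this set,
    [right_step] forbids it to lie before [b]. [left_step] takes the place of continuity, so that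
    infinite slopes can be treated too. *)
Lemma le_by_real_induction (phi : R -> R) (a b : R) : a <= b ->
  (forall c, a < c <= b ->
     (forall eta, 0 < eta -> exists2 u, a <= u < c /\ c - eta < u & phi a <= phi u) ->
     phi a <= phi c) ->
  (forall c, a <= c < b -> exists2 d, c < d <= b & phi c <= phi d) ->
  phi a <= phi b.
Proof.
move=> ab left_step right_step.
pose T := [set u | a <= u <= b /\ phi a <= phi u].
have Ta : T a by split=> //; rewrite lexx.
have Tub : ubound T b by move=> u [/andP[]].
have supT : has_sup T by split; [exists a|exists b].
have ac : a <= sup T by apply: ub_le_sup => //; exists b.
have cb : sup T <= b by apply: ge_sup => //; exists a.
have Tc : T (sup T).
  apply: contrapT => nTc.
  have ca : sup T != a by apply/eqP => c0'; apply: nTc; rewrite c0'.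
  apply: (nTc); split; first by rewrite ac.
  apply: left_step; first by rewrite lt_neqAle eq_sym ca ac.
  move=> eta eta0; have [u Tu uc] := sup_adherent eta0 supT.
  have := ub_le_sup (ex_intro _ b Tub) Tu; rewrite le_eqVlt => /orP[/eqP uE|uc'].
    by exfalso; apply: nTc; rewrite -uE.
  by exists u; [rewrite uc' uc; case: Tu => /andP[-> _]|case: Tu].
have [/eqP <-|cnb] := boolP (sup T == b); first by case: Tc.
have [|d /andP[cd db] cdP] := right_step (sup T); first by rewrite ac lt_neqAle cnb.
have : T d by split; [rewrite db (le_trans ac (ltW cd))|case: Tc => _ /le_trans; apply].
by move=> /(ub_le_sup (ex_intro _ b Tub)); rewrite leNgt cd.
Qed.

(** Continuity provides the left step: [phi c < phi a] would persist at nearby points to the left of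
    [c]. *)
Lemma le_by_right_steps (phi : R -> R) (a b : R) : a <= b ->
  (forall c, a <= c <= b -> forall eta, 0 < eta -> exists2 d, 0 < d &
     forall u, a <= u <= b -> `|c - u| < d -> `|phi c - phi u| < eta) ->
  (forall c, a <= c < b -> exists2 d, c < d <= b & phi c <= phi d) ->
  phi a <= phi b.
Proof.
move=> ab cphi; apply: le_by_real_induction => // c /andP[ac cb] cu.
rewrite leNgt; apply/negP => lt_c.
have [|d d0 Hd] := cphi c _ (phi a - phi c) ltac:(lra); first by rewrite (ltW ac).
have [u [/andP[au uc] cdu] phiu] := cu d d0.
have : `|phi c - phi u| < phi a - phi c by apply: Hd; [lra | rewrite ger0_norm; lra].
by rewrite ltr_norml; lra.
Qed.

End RealInduction.

(** * Slopes along a direction and generic strict derivability *)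

Section Slopes.
Variables (R : realType) (D : forall n, set (set 'rV[R]_n)).
Arguments D : clear implicits.
Hypothesis hD : o_minimal D.
Variables (n : nat) (Omega : set 'rV[R]_n) (e : 'rV[R]_n).
Hypothesis Omega_open : open Omega.

Definition definable_fun (g : 'rV[R]_n -> R) :=
  definable D (fun p : 'rV[R]_n * R^o => Omega p.1 /\ p.2 = g p.1).

(* Only increments with [t > 0] are considered: as the base point y varies too, those
   with [t < 0] are covered by exchanging the two endpoints. *)
Definition increment_ge (g : 'rV[R]_n -> R) (y : 'rV[R]_n) (t p : R) :=
  [/\ Omega y, Omega (y + t *: e) & p * t <= g (y + t *: e) - g y].

(** The base point [y] moves near [z] together with [t], as in Clarke's strict derivatives; the
    admissible [p] form a down-set whose supremum is the candidate derivative. *)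
Definition slope_ge (g : 'rV[R]_n -> R) (z : 'rV[R]_n) (p : R) :=
  exists2 d : R, 0 < d & forall y t, `|z - y| < d -> 0 < t < d -> increment_ge g y t p.

(** The upper bound on slopes is written as a lower bound for [\- g], so that only [slope_ge] has to
    be studied. *)
Definition strict_derivable_along (g : 'rV[R]_n -> R) (z : 'rV[R]_n) (a : R) :=
  forall eps, 0 < eps -> slope_ge g z (a - eps) /\ slope_ge (\- g) z (- (a + eps)).

Lemma definable_fun_opp g : definable_fun g -> definable_fun (\- g).
Proof.
move=> dg; have lN : affine_map (fun p : 'rV[R]_n * R^o => (p.1, - p.2)) by affine.
apply: definable_ext (definable_comp hD lN dg) => -[y u] /=.
by split=> -[Oy]; [move=> <-; rewrite opprK|move=> ->; rewrite opprK].
Qed.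

Lemma slope_geW g z p q : p <= q -> slope_ge g z q -> slope_ge g z p.
Proof.
move=> pq [d d0 zd]; exists d => // y t zy td.
have [Oy Oyt h] := zd y t zy td; split=> //.
by apply: le_trans h; apply: ler_wpM2r => //; lra.
Qed.

Section one_function.
Variable g : 'rV[R]_n -> R.
Hypothesis dg : definable_fun g.

Lemma definable_increment_ge :
  definable D (fun q : 'rV[R]_n * R^o * R^o => increment_ge g q.1.1 q.1.2 q.2).
Proof.
(* Atoms take affine terms only, so [u], [v] and [w] name the two values of [g] and the product
   [p * t]. *)
apply: (definable_ext (P := fun q : 'rV[R]_n * R^o * R^o =>
  exists u v w : R^o, ((Omega q.1.1 /\ u = g q.1.1) /\
    (Omega (q.1.1 + (q.1.2 : R) *: e) /\ v = g (q.1.1 + (q.1.2 : R) *: e))) /\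
    (w = (q.2 : R) * (q.1.2 : R) /\ (w : R) <= ((v - u : R^o) : R)))).
  move=> [[y t] p] /=; split.
    by move=> [u [v [w [[[Oy ->] [Oyt ->]] [-> h]]]]]; split.
  by move=> [Oy Oyt h]; exists (g y), (g (y + (t : R) *: e)), (p * t).
apply: (definable_ex hD); apply: (definable_ex hD); apply: (definable_ex hD).
apply: (definable_and hD); apply: (definable_and hD).
- have la : affine_map (fun q : 'rV[R]_n * R^o * R^o * R^o * R^o * R^o =>
    (q.1.1.1.1.1, q.1.1.2)) by affine.
  exact: (definable_comp hD la dg).
- have la : affine_map (fun q : 'rV[R]_n * R^o * R^o * R^o * R^o * R^o =>
    (q.1.1.1.1.1 + (q.1.1.1.1.2 : R) *: e, q.1.2)) by affine.
  exact: (definable_comp hD la dg).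
- by apply: (definable_mul hD); affine.
- by apply: (definable_le hD); affine.
Qed.

Lemma definable_slope_ge :
  definable D (fun q : 'rV[R]_n * R^o => slope_ge g q.1 q.2).
Proof.
apply: (definable_ext (P := fun q : 'rV[R]_n * R^o => exists d : R^o,
  0 < (d : R) /\ forall (y : 'rV[R]_n) (t : R^o), `|q.1 - y| < (d : R) ->
   (0 < (t : R) /\ (t : R) < (d : R)) -> increment_ge g y t q.2)).
  move=> [z p] /=; split=> [[d [d0 h]]|[d d0 h]]; exists d => //.
    by move=> y t zy /andP td; exact: h.
  by split=> // y t zy /andP td; exact: h.
apply: (definable_ex hD); apply: (definable_and hD).
  by apply: (definable_lt hD); affine.
apply: (definable_all hD); apply: (definable_all hD); apply: (definable_imply hD).
  by apply: (definable_norm_lt hD); affine.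
apply: (definable_imply hD).
  by apply: (definable_and hD); apply: (definable_lt hD); affine.
have la : affine_map (fun q : 'rV[R]_n * R^o * R^o * 'rV[R]_n * R^o =>
  (q.1.2, q.2, q.1.1.1.2)) by affine.
exact: (definable_comp hD la definable_increment_ge).
Qed.

End one_function.

Lemma definable_strict_derivable g : definable_fun g ->
  definable D (fun z => exists a, strict_derivable_along g z a).
Proof.
move=> dg; rewrite /strict_derivable_along.
apply: (@definable_ex _ _ hD _ R^o).
apply: (@definable_all _ _ hD _ R^o).
apply: (definable_imply hD); first by apply: (definable_lt hD); affine.
apply: (definable_and hD).
  have la : affine_map (fun q : 'rV[R]_n * R^o * R^o => (q.1.1, q.1.2 - q.2)) by affine.
  exact: (definable_comp hD la (definable_slope_ge dg)).
have la : affine_map (fun q : 'rV[R]_n * R^o * R^o => (q.1.1, - (q.1.2 + q.2))) by affine.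
exact: (definable_comp hD la (definable_slope_ge (definable_fun_opp dg))).
Qed.

(** For fixed [y], o-minimality fixes the sign of the increment minus [p * t] for [0 < t < 1/(k+1)];
    the cover argument makes [k] and the sign common to all [y] in an open [V], which bounds the
    strict slopes at every point of [V]. *)
Lemma slope_dichotomy g (p : R) W : definable_fun g ->
  open W -> W !=set0 -> W `<=` Omega ->
  exists V, [/\ open V, V !=set0, V `<=` W &
    (forall z, V z -> slope_ge g z p) \/ (forall z, V z -> slope_ge (\- g) z (- p))].
Proof.
move=> dg oW W0 WO.
pose S (b : bool) y (t : R^o) :=
  if b then increment_ge g y t p else increment_ge (\- g) y t (- p).
pose A (kb : nat * bool) := [set y : 'rV[R]_n | forall t : R^o,
  0 < (t : R) < kb.1.+1%:R^-1 -> S kb.2 y t].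
have dS b : definable D (fun q : 'rV[R]_n * R^o => S b q.1 q.2).
  case: b.
    have la : affine_map (fun q : 'rV[R]_n * R^o => (q.1, q.2, (p : R^o))) by affine.
    exact: (definable_comp hD la (definable_increment_ge dg)).
  have la : affine_map (fun q : 'rV[R]_n * R^o => (q.1, q.2, (- p : R^o))) by affine.
  exact: (definable_comp hD la (definable_increment_ge (definable_fun_opp dg))).
have dA kb : D n (A kb).
  apply/(proj2 (definable_rV hD _)); apply: (definable_all hD).
  apply: (definable_imply hD) => //.
  apply: (definable_ext (P := fun q => 0 < (q.2 : R) /\ (q.2 : R) < kb.1.+1%:R^-1)).
    by move=> q; split=> /andP.
  by apply: (definable_and hD); apply: (definable_lt hD); affine.
have WA : W `<=` \bigcup_kb A kb.
  move=> y /WO Oy.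
  (* Keeps [y + t *: e] in [Omega], so that [increment_ge] can fail only through its inequality. *)
  have [r r0 rO] : exists2 r : R, 0 < r & forall t, 0 < t < r -> Omega (y + t *: e).
    have [r r0 rO] := open_normP Omega_open Oy.
    exists (r / (`|e| + 1)); first by rewrite divr_gt0.
    move=> t /andP[t0]; rewrite ltr_pdivlMr // => tr; apply: rO.
    rewrite opprD addrA subrr add0r normrN normrZ gtr0_norm //.
    by apply: le_lt_trans tr; apply: ler_wpM2l; lra.
  have : right_germ (S true y) 0.
    apply: (definable_right_germ hD).
    have la : affine_map (fun t : R^o => (y, t)) by affine.
    exact: (definable_comp hD la (dS true)).
  move=> [d d0 H].
  have [k] : exists k, k.+1%:R^-1 < Num.min r d :> R.
    have : 0 < Num.min r d by rewrite lt_min r0.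
    by move=> /ltr_add_invr[k]; rewrite add0r; exists k.
  rewrite lt_min => /andP[kr kd].
  case: H => H.
    exists (k, true) => // t /andP[t0 /= tk]; apply: H.
    by rewrite t0 (lt_trans tk).
  exists (k, false) => // t /andP[t0 /= tk].
  have Oyt : Omega (y + (t : R) *: e) by apply: rO; rewrite t0 (lt_trans tk).
  split=> //; have := H t; rewrite t0 (lt_trans tk)// => /(_ isT) nS.
  have : ~ (p * t <= g (y + (t : R) *: e) - g y) by move=> h; apply: nS; split.
  by move=> /negP; rewrite -ltNge /= => /ltW; rewrite mulNr -opprD lerN2.
have [[k b] [V [oV V0 VW VA]]] := definable_cover hD dA oW W0 WA.
exists V; split=> //.
have slope b' : (forall z, V z -> A (k, b') z) -> forall z, V z ->
    if b' then slope_ge g z p else slope_ge (\- g) z (- p).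
  move=> VA' z Vz; have [r r0 rV] := open_normP oV Vz.
  pose d := Num.min r k.+1%:R^-1.
  have d0 : 0 < d by rewrite lt_min r0 invr_gt0 ltr0n.
  have H y t : `|z - y| < d -> 0 < t < d -> S b' y t.
    rewrite !lt_min => /andP[zr _] /andP[t0 /andP[_ tk]].
    by apply: (VA' _ (rV _ zr)); rewrite t0.
  by case: b' H {VA'} => H; exists d.
by case: b VA => VA; [left|right] => z Vz; [apply: (slope true)|apply: (slope false)].
Qed.

(** Arbitrarily large slopes at every point of a segment in [W] would give
    [M * b <= g (z + b *: e) - g z] for all [M], by real induction along the segment. *)
Lemma slope_not_infinite g W : open W -> W !=set0 ->
  ~ forall z, W z -> forall p, slope_ge g z p.
Proof.
move=> oW [z Wz] H; have [r r0 rW] := open_normP oW Wz.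
(* Short enough for the segment from [z] to [z + b *: e] to stay within [r] of [z]. *)
pose b := r / (2 * (`|e| + 1)).
have e0 : 0 < `|e| + 1 by rewrite ltr_wpDl.
have b0 : 0 < b by rewrite divr_gt0 // mulr_gt0.
have Wline c : 0 <= c <= b -> W (z + c *: e).
  move=> /andP[c0 cb]; apply: rW.
  rewrite opprD addrA subrr add0r normrN normrZ ger0_norm //.
  have : b * (2 * (`|e| + 1)) = r by rewrite divfK // gt_eqF // mulr_gt0.
  have := normr_ge0 e; nra.
have main M : M * b <= g (z + b *: e) - g z.
  pose phi u := g (z + u *: e) - M * u.
  suff : phi 0 <= phi b by rewrite /phi scale0r addr0; lra.
  have step c : 0 <= c <= b -> exists2 d, 0 < d & forall u v,
      `|c - u| < d -> u < v < u + d -> phi u <= phi v.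
    move=> cb; have [d d0 Hd] := H _ (Wline c cb) M.
    (* Keeps [z + u *: e] within [d] of [z + c *: e] and [v - u] below [d]. *)
    exists (d / (`|e| + 1)); first by rewrite divr_gt0.
    have ded : d / (`|e| + 1) <= d.
      by rewrite ler_pdivrMr // ler_peMr ?(ltW d0)// lerDr.
    move=> u v cu uv; have [||_ _] := Hd (z + u *: e) (v - u).
    - rewrite opprD addrACA subrr add0r -scalerBl normrZ.
      move: cu; rewrite ltr_pdivlMr // => cu.
      by apply: le_lt_trans cu; rewrite ler_wpM2l // lerDl.
    - by lra.
    by rewrite -addrA -scalerDl (addrC u) subrK /phi; lra.
  apply: le_by_real_induction; first exact: ltW.
    move=> c cb.
    have [d d0 Hd] := step c ltac:(lra).
    move=> /(_ d d0)[u uc /le_trans]; apply; apply: Hd; last lra.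
    by rewrite ger0_norm; lra.
  move=> c cb; have [d d0 Hd] := step c ltac:(lra).
  exists (Num.min b (c + d / 2)); rewrite ?ge_min ?lexx ?andbT.
    by rewrite lt_min; lra.
  apply: Hd; first by rewrite subrr normr0.
  have : c < Num.min b (c + d / 2) by rewrite lt_min; lra.
  have : Num.min b (c + d / 2) <= c + d / 2 by rewrite ge_min lexx orbT.
  lra.
have := main ((g (z + b *: e) - g z + 1) / b).
by rewrite divfK ?gt_eqF //; lra.
Qed.

(** Countably many definable sets cover [W]: the derivable points, the points of infinite slope of
    either sign, and for each rational [p] the points where [two_sided] fails. By
    [slope_not_infinite] and [slope_dichotomy] only the first can contain a nonempty open set. *)
Lemma strict_derivable_somewhere g W : definable_fun g ->
  open W -> W !=set0 -> W `<=` Omega ->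
  exists V, [/\ open V, V !=set0, V `<=` W &
    forall z, V z -> exists a, strict_derivable_along g z a].
Proof.
move=> dg oW W0 WO.
pose inf h := fun z => forall p : R^o, slope_ge h z p.
pose two_sided p z := slope_ge g z p \/ slope_ge (\- g) z (- p).
pose A (i : option (bool + rat)) := match i with
  | None => [set z | exists a, strict_derivable_along g z a]
  | Some (inl true) => [set z | inf g z]
  | Some (inl false) => [set z | inf (\- g) z]
  | Some (inr p) => [set z | ~ two_sided (ratr p) z]
  end.
have dinf h : definable_fun h -> definable D (inf h).
  move=> dh; apply: (definable_all hD).
  exact: definable_slope_ge.
have dA i : D n (A i).
  apply/(proj2 (definable_rV hD _)); case: i => [[[]|p]|] /=.
  - exact: dinf.
  - exact/dinf/definable_fun_opp.
  - apply: (definable_not hD); apply: (definable_or hD).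
      have la : affine_map (fun z : 'rV[R]_n => (z, (ratr p : R^o))) by affine.
      exact: (definable_comp hD la (definable_slope_ge dg)).
    have la : affine_map (fun z : 'rV[R]_n => (z, (- ratr p : R^o))) by affine.
    exact: (definable_comp hD la (definable_slope_ge (definable_fun_opp dg))).
  - exact: definable_strict_derivable.
have WA : W `<=` \bigcup_i A i.
  move=> z _; apply: contrapT => nA.
  have twoP (p : rat) : two_sided (ratr p) z.
    by apply: contrapT => np; apply: nA; exists (Some (inr p)).
  have [q nq] : exists q, ~ slope_ge g z q.
    apply: contrapT => nq; apply: nA; exists (Some (inl true)) => // q.
    by apply: contrapT => h; apply: nq; exists q.
  have [q' nq'] : exists q, ~ slope_ge (\- g) z q.
    apply: contrapT => nq'; apply: nA; exists (Some (inl false)) => // p.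
    by apply: contrapT => h; apply: nq'; exists p.
  pose S := [set p | slope_ge g z p].
  have S0 : S !=set0.
    (* As [- p] exceeds [q'], the second alternative of [two_sided] fails at [z], which puts [p] in
       [S]. *)
    have [p] := @rat_in_itvoo R (- q' - 1) (- q') ltac:(lra).
    rewrite in_itv /= => /andP[_ pq']; exists (ratr p).
    by case: (twoP p) => // h; exfalso; apply: nq'; apply: slope_geW h; lra.
  have Sub : ubound S q.
    by move=> p Sp; rewrite leNgt; apply/negP => /ltW qp; apply: nq; apply: slope_geW Sp.
  have hS : has_sup S by split=> //; exists q.
  apply: nA; exists None => //; exists (sup S) => eps eps0; split.
    by have [p Sp /ltW h] := sup_adherent eps0 hS; exact: slope_geW Sp.
  (* A rational [p] above [sup S] is not in [S], so [two_sided] bounds the slopes from above by [p],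
     which is below [sup S + eps]. *)
  have [p] := @rat_in_itvoo R (sup S) (sup S + eps) ltac:(lra).
  rewrite in_itv /= => /andP[Sp pe].
  have [/(ub_le_sup (ex_intro _ q Sub))|] := twoP p; first by rewrite leNgt Sp.
  by apply: slope_geW; lra.
have [i [V [oV V0 VW VA]]] := definable_cover hD dA oW W0 WA.
case: i VA => [[[]|p]|] /= VA.
- by exfalso; apply: (@slope_not_infinite g V).
- by exfalso; apply: (@slope_not_infinite (\- g) V).
- have [V' [_ [z V'z] V'V H]] :=
    @slope_dichotomy g (ratr p) V dg oV V0 (subset_trans VW WO).
  exfalso; apply: (VA z (V'V _ V'z)).
  by case: H => H; [left|right]; apply: H.
- by exists V.
Qed.

End Slopes.

(** * From strict partial derivatives to class C^1 *)

Section StrictDifferentiability.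
Variables (R : realType).

Lemma common_radius (I : finType) (P : I -> R -> Prop) :
  (forall i d d', d' <= d -> P i d -> P i d') ->
  (forall i, exists2 d, 0 < d & P i d) -> exists2 d, 0 < d & forall i, P i d.
Proof.
move=> Pmon Pex.
have [d d0 Pd] : exists2 d, 0 < d & forall i, i \in enum I -> P i d.
  elim: (enum I) => [|i s [d d0 Pd]]; first by exists 1.
  have [d' d'0 Pd'] := Pex i.
  exists (Num.min d d'); first by rewrite lt_min d0.
  move=> j; rewrite in_cons => /orP[/eqP ->|js].
    by apply: Pmon Pd'; rewrite ge_min lexx orbT.
  by apply: Pmon (Pd _ js); rewrite ge_min lexx.
by exists d => // i; apply: Pd; rewrite mem_enum.
Qed.

Variable n : nat.
Implicit Types (f : 'rV[R]_n -> 'rV[R]_n) (A : 'M[R]_n) (y z : 'rV[R]_n).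

(** Both endpoints move; when such an [A] exists at each point of an open set, [f] is already C^1
    there, by [strict_diff_C1]. *)
Definition strict_diff f z A := forall eps, 0 < eps ->
  exists2 d, 0 < d & forall y y', `|z - y| < d -> `|z - y'| < d ->
    `|f y' - f y - (y' - y) *m A| <= eps * `|y' - y|.

(** A negative [t] is reduced to a positive one by exchanging the endpoints, which is why both are
    kept near [z]. *)
Lemma strict_derivable_increment (Omega : set 'rV[R]_n) (i : 'I_n) g z a :
  strict_derivable_along Omega (delta_mx 0 i) g z a ->
  forall eps, 0 < eps -> exists2 d, 0 < d & forall y t, `|z - y| < d ->
    `|z - (y + t *: delta_mx 0 i)| < d ->
    `|g (y + t *: delta_mx 0 i) - g y - t * a| <= eps * `|t|.
Proof.
move=> ga eps eps0; have [[d1 d10 H1] [d2 d20 H2]] := ga eps eps0.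
pose d := Num.min d1 d2.
have d0 : 0 < d by rewrite lt_min d10.
(* Two points within [d / 2] of [z] differ by less than [d], which bounds [t]. *)
exists (d / 2); first by rewrite divr_gt0.
have pos y t : `|z - y| < d / 2 -> 0 < t < d ->
    `|g (y + t *: delta_mx 0 i) - g y - t * a| <= eps * `|t|.
  rewrite lt_min => zy /andP[t0 /andP[td1 td2]].
  have dd1 : d <= d1 by rewrite ge_min lexx.
  have dd2 : d <= d2 by rewrite ge_min lexx orbT.
  have [_ _ h1] := H1 y t ltac:(lra) ltac:(by rewrite t0).
  have [_ _ h2] := H2 y t ltac:(lra) ltac:(by rewrite t0).
  rewrite /= in h2; rewrite (gtr0_norm t0) ler_norml; apply/andP; split; nra.
move=> y t zy zyt.
have td : `|t| < d.
  have -> : `|t| = `|(y + t *: delta_mx 0 i - y) 0 i|.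
    by rewrite addrC addKr !mxE !eqxx mulr1.
  apply: le_lt_trans (le_rV_norm _ _) _.
  rewrite -(subrK z (y + _)) -addrA (le_lt_trans (ler_normD _ _))// (distrC (y + _)); lra.
have [tn|tp|->] := ltgtP t 0.
- have := pos (y + t *: delta_mx 0 i) (- t) zyt.
  rewrite scaleNr addrK normrN => /(_ _)/=.
  rewrite (ltr0_norm tn) in td; rewrite oppr_gt0 tn td => /(_ isT).
  apply: le_trans; rewrite -[leRHS]normrN le_eqVlt; apply/orP; left; apply/eqP.
  by congr `|_|; ring.
- by apply: pos => //; rewrite tp -(gtr0_norm tp).
- by rewrite scale0r addr0 subrr mul0r subr0 normr0 mulr0.
Qed.

(** Passes from [y] to [y'] one coordinate at a time; the intermediate points stay in the ball
    because the norm is the maximum norm, and strictness lets the base point move. *)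
Lemma strict_diff_of_partials (Omega : set 'rV[R]_n) f z :
  (forall i j, exists a,
     strict_derivable_along Omega (delta_mx 0 i) (fun y => f y 0 j) z a) ->
  exists A, strict_diff f z A.
Proof.
move=> /(_ _ _)/cid H.
pose A : 'M[R]_n := \matrix_(i, j) sval (H i j).
have HA i j : strict_derivable_along Omega (delta_mx 0 i) (fun y => f y 0 j) z (A i j).
  by rewrite mxE; exact: svalP.
exists A => eps eps0.
(* Shares [eps] among the [n] coordinate steps; the successor avoids a division by 0. *)
pose e := eps / n.+1%:R.
have e0 : 0 < e by rewrite divr_gt0.
have [d d0 Hd] : exists2 d, 0 < d & forall ij : 'I_n * 'I_n, forall y t, `|z - y| < d ->
    `|z - (y + t *: delta_mx 0 ij.1)| < d ->
    `|f (y + t *: delta_mx 0 ij.1) 0 ij.2 - f y 0 ij.2 - t * A ij.1 ij.2| <= e * `|t|.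
  apply: common_radius => [ij d d' dd' h y t zy zyt|ij].
    by apply: h; apply: lt_le_trans dd'.
  exact: strict_derivable_increment (HA _ _) e e0.
exists d => // y y' zy zy'.
pose mix k : 'rV[R]_n := \row_i (if (i < k)%N then y' 0 i else y 0 i).
have mix0 : mix 0 = y by apply/rowP => i; rewrite mxE.
have mixn : mix n = y' by apply/rowP => i; rewrite mxE ltn_ord.
have mixS (k : 'I_n) : mix k.+1 = mix k + (y' 0 k - y 0 k) *: delta_mx 0 k.
  apply/rowP => i; rewrite !mxE eqxx /= ltnS leq_eqVlt.
  have [->|ik] := eqVneq i k; first by rewrite eqxx ltnn /= mulr1 addrC subrK.
  by rewrite (inj_eq val_inj) (negbTE ik) /= mulr0 addr0.
have zmix k : `|z - mix k| < d.
  apply/rV_norm_ltP; split=> // i; rewrite !mxE.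
  move: zy zy' => /rV_norm_ltP[_ /(_ i)] + /rV_norm_ltP[_ /(_ i)].
  by rewrite !mxE; case: ifP.
apply/rV_norm_leP; split=> [|j]; first by rewrite mulr_ge0 // ltW.
have -> : (f y' - f y - (y' - y) *m A) 0 j =
    \sum_(k < n) (f (mix k.+1) 0 j - f (mix k) 0 j - (y' 0 k - y 0 k) * A k j).
  rewrite big_split /= sumrN -(big_mkord xpredT (fun k => f (mix k.+1) 0 j - f (mix k) 0 j)).
  rewrite (telescope_sumr (fun k => f (mix k) 0 j))// mix0 mixn !mxE.
  by congr (_ - _); apply: eq_bigr => i _; rewrite !mxE.
apply: le_trans (ler_norm_sum _ _ _) _.
apply: (@le_trans _ _ (\sum_(k < n) e * `|y' - y|)).
  apply: ler_sum => k _; rewrite mixS.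
  apply: le_trans (Hd (k, j) _ _ _ _) _; rewrite -?mixS//.
  rewrite ler_pM2l //; have := le_rV_norm (y' - y) k; by rewrite !mxE.
rewrite sumr_const card_ord -mulr_natr mulrAC ler_wpM2r // /e.
by rewrite mulrAC ler_pdivrMr // ler_wpM2l // ?ler_nat // ltW.
Qed.

Lemma continuous_mulmxr A : continuous (mulmxr A : 'rV[R]_n -> 'rV[R]_n).
Proof.
apply/linear_bounded_continuous/bounded_funP => r.
exists (\sum_j \sum_i r * `|A i j|) => v vr.
have r0 : 0 <= r by exact: le_trans vr.
apply/rV_norm_leP; split=> [|j].
  by do 2?[apply: sumr_ge0 => ? _]; rewrite mulr_ge0.
rewrite (bigD1 j) //= mxE; apply: le_trans (ler_norm_sum _ _ _) _.
rewrite -[leLHS]addr0 lerD //; last first.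
  by do 2?[apply: sumr_ge0 => ? _]; rewrite mulr_ge0.
by apply: ler_sum => i _; rewrite normrM ler_wpM2r //; apply: le_trans (le_rV_norm _ _) vr.
Qed.

Lemma strict_diff_differentiable f z A : strict_diff f z A ->
  differentiable f z /\ 'J f z = A.
Proof.
move=> fA.
have cA := @continuous_mulmxr A.
have E : f \o shift z = cst (f z) + mulmxr A +o_ (0 : 'rV[R]_n) id.
  apply/eqaddoP => eps eps0.
  have [d d0 Hd] := fA eps eps0.
  near=> h.
  have hd : `|h| < d.
    near: h; apply/nbhs_ballP; exists d => // h; rewrite -ball_normE /= sub0r normrN //.
  have := Hd z (h + z).
  rewrite subrr normr0 opprD addrCA subrr addr0 normrN addrK => /(_ d0 hd).
  by rewrite /= !fctE /= opprD addrA.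
have dE := diff_unique cA E.
split; first by apply/diff_locallyP; rewrite dE.
by apply/matrixP => i j; rewrite /jacobian dE mxE /= -rowE mxE.
Unshelve. all: by end_near.
Qed.


(** Both linear approximations are compared on one increment [t *: delta_mx 0 i] from [w]: the
    entries differ by at most [e] once [t] is divided out. *)
Lemma strict_diff_jacobian_continuous f z A e : strict_diff f z A -> 0 < e ->
  exists2 d, 0 < d & forall w A', `|z - w| < d -> strict_diff f w A' -> forall i j,
    `|A i j - A' i j| <= e.
Proof.
move=> fA e0; have e20 : 0 < e / 2 by rewrite divr_gt0.
have [d d0 Hd] := fA _ e20; exists d => // w A' zw fA' i j.
have [d' d'0 Hd'] := fA' _ e20.
pose t := Num.min d' (d - `|z - w|) / 2.
have t0 : 0 < t by rewrite divr_gt0 // lt_min d'0 subr_gt0.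
have td' : 2 * t <= d' by rewrite mulrC divfK // ge_min lexx.
have td : 2 * t <= d - `|z - w| by rewrite mulrC divfK // ge_min lexx orbT.
pose h : 'rV[R]_n := t *: delta_mx 0 i.
have hn : `|h| <= t.
  apply/rV_norm_leP; split=> [|k]; first exact: ltW.
  rewrite !mxE eqxx /= normrM (gtr0_norm t0).
  by case: (k == i); rewrite ?normr1 ?normr0 ?mulr1 ?mulr0 // ltW.
have hA B : (h *m B) 0 j = t * B i j by rewrite -scalemxAl mxE -rowE mxE.
have whw : w + h - w = h by rewrite addrC addKr.
have coordle (v : 'rV[R]_n) : `|v| <= e / 2 * `|h| -> `|v 0 j| <= e / 2 * t.
  move=> vh; apply: le_trans (le_rV_norm _ _) (le_trans vh _).
  by rewrite ler_wpM2l // ltW.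
have /coordle : `|f (w + h) - f w - h *m A| <= e / 2 * `|h|.
  have := Hd w (w + h); rewrite whw; apply => //.
  by rewrite opprD addrA; apply: le_lt_trans (ler_normB _ _) _; lra.
have /coordle : `|f (w + h) - f w - h *m A'| <= e / 2 * `|h|.
  have := Hd' w (w + h); rewrite whw subrr normr0; apply => //.
  by rewrite opprD addrA subrr add0r normrN; lra.
rewrite ![(_ - _ *m _) 0 j]mxE ![(- (_ *m _)) 0 j]mxE !hA !ler_norml.
move=> /andP[a1 a2] /andP[b1 b2].
have : t * (A i j - A' i j) <= t * e by nra.
have : - (t * e) <= t * (A i j - A' i j) by nra.
rewrite -mulrN !ler_pM2l // => -> ->//.
Qed.

Lemma strict_diff_C1 f (V : set 'rV[R]_n) : open V ->
  (forall z, V z -> exists A, strict_diff f z A) -> C1_on V f.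
Proof.
move=> oV sd; split=> [y Vy|].
  by have [A /strict_diff_differentiable[]] := sd y Vy.
rewrite continuous_open_subspace // => y; rewrite inE => Vy.
have [A fA] := sd y Vy; have [_ JA] := strict_diff_differentiable fA.
apply/(@cvgrPdist_le _ _ _ _ (nbhs_filter y)) => e e0; rewrite JA.
have [d d0 Hd] := strict_diff_jacobian_continuous fA e0.
have [r r0 rV] := open_normP oV Vy.
apply/nbhs_ballP; exists (Num.min d r); first by rewrite /= lt_min d0.
move=> w; rewrite -ball_normE => yw.
move: yw; rewrite /= lt_min => /andP[yd /rV Vw].
have [A' fA'] := sd w Vw; have [_ ->] := strict_diff_differentiable fA'.
rewrite [leLHS]mx_normrE; apply: bigmax_le => [|[i j] _]; first exact: ltW.
by rewrite !mxE; apply: Hd fA' _ _.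
Qed.

End StrictDifferentiability.

(** * The singular set, and the endpoints [x'] whose segment does not run along it *)

Section SingularSet.
Variables (R : realType) (D : forall n, set (set 'rV[R]_n)).
Arguments D : clear implicits.
Hypothesis hD : o_minimal D.
Variables (n : nat) (Omega : set 'rV[R]_n) (f : 'rV[R]_n -> 'rV[R]_n).
Hypothesis Omega_open : open Omega.
Hypothesis Omega_def : D n Omega.
Hypothesis f_def : definable_map D Omega f.

Definition strict_partials (z : 'rV[R]_n) := forall i j, exists a,
  strict_derivable_along Omega (delta_mx 0 i) (fun y => f y 0 j) z a.

(* A superset of B_f given by a first-order formula. *)
Definition singular : set 'rV[R]_n := [set z | Omega z /\
  ~ exists2 d : R, 0 < d & forall y, `|z - y| < d -> strict_partials y].

Lemma definable_fun_coord (j : 'I_n) : definable_fun D Omega (fun y => f y 0 j).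
Proof.
apply: (definable_ext (P := fun p : 'rV[R]_n * R^o =>
  exists w : 'rV[R]_n, (Omega p.1 /\ w = f p.1) /\ p.2 = w 0 j)).
  move=> [y u] /=; split=> [[w [[Oy ->] ->]]//|[Oy ->]].
  by exists (f y).
apply: (definable_ex hD); apply: (definable_and hD).
  have la : affine_map (fun q : 'rV[R]_n * R^o * 'rV[R]_n => row_mx q.1.1 q.2).
    by affine.
  apply: definable_ext (definable_comp hD la (proj1 (definable_rV hD _) f_def)).
  by move=> q /=; rewrite row_mxKl row_mxKr.
by apply: (definable_eq hD); affine.
Qed.

Lemma definable_singular : definable D singular.
Proof.
apply: (definable_ext (P := fun z => Omega z /\ ~ exists d : R^o, 0 < (d : R) /\
    forall y : 'rV[R]_n, `|z - y| < (d : R) -> strict_partials y)).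
  move=> z; split=> -[Oz nd]; split=> // -[d].
    by move=> d0 H; apply: nd; exists d.
  by move=> [d0 H]; apply: nd; exists d.
apply: (definable_and hD); first exact/(proj1 (definable_rV hD _)).
apply: (definable_not hD); apply: (definable_ex hD).
apply: (definable_and hD); first by apply: (definable_lt hD); affine.
apply: (definable_all hD); apply: (definable_imply hD).
  by apply: (definable_norm_lt hD); affine.
have dP : definable D strict_partials.
  apply: (definable_all_fin hD) => i; apply: (definable_all_fin hD) => j.
  exact: definable_strict_derivable (definable_fun_coord j).
have la : affine_map (fun q : 'rV[R]_n * R^o * 'rV[R]_n => q.2) by affine.
exact: (definable_comp hD la dP).
Qed.

Lemma somewhere_all (I : finType) (P : I -> 'rV[R]_n -> Prop) :
  (forall i W, open W -> W !=set0 -> W `<=` Omega ->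
    exists V, [/\ open V, V !=set0, V `<=` W & forall z, V z -> P i z]) ->
  forall W, open W -> W !=set0 -> W `<=` Omega ->
    exists V, [/\ open V, V !=set0, V `<=` W & forall z, V z -> forall i, P i z].
Proof.
move=> HP W oW W0 WO.
suff [V [oV V0 VW HV]] : exists V, [/\ open V, V !=set0, V `<=` W &
    forall z, V z -> forall i, i \in enum I -> P i z].
  by exists V; split=> // z Vz i; apply: HV; rewrite ?mem_enum.
elim: (enum I) => [|i s [V [oV V0 VW HV]]]; first by exists W; split.
have [V' [oV' V'0 V'V HV']] := HP i V oV V0 (subset_trans VW WO).
exists V'; split=> //; first exact: subset_trans V'V VW.
move=> z V'z j; rewrite in_cons => /orP[/eqP ->|]; first exact: HV'.
exact: HV (V'V _ V'z) j.
Qed.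

Lemma singular_nowhere_dense W : open W -> W !=set0 -> W `<=` Omega ->
  exists V, [/\ open V, V !=set0, V `<=` W & V `&` singular = set0].
Proof.
move=> oW W0 WO.
have [V [oV V0 VW HV]] : exists V, [/\ open V, V !=set0, V `<=` W &
    forall z, V z -> forall ij : 'I_n * 'I_n, exists a,
      strict_derivable_along Omega (delta_mx 0 ij.1) (fun y => f y 0 ij.2) z a].
  apply: somewhere_all oW W0 WO => ij {}W oW W0 WO.
  exact: (strict_derivable_somewhere hD _ Omega_open (definable_fun_coord _) oW W0 WO).
exists V; split=> //; apply/seteqP; split=> // z [Vz [_ ns]].
have [r r0 rV] := open_normP oV Vz.
by apply: ns; exists r => // y zy i j; exact: (HV y (rV _ zy) (i, j)).
Qed.

(** Places B_f inside [singular], and provides the strict expansion on which the mean value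
    inequality rests. *)
Lemma regular_point z : Omega z -> ~ singular z ->
  ~ non_C1 Omega f z /\ strict_diff f z ('J f z).
Proof.
move=> Oz ns.
have [d d0 Hd] : exists2 d : R, 0 < d & forall y, `|z - y| < d -> strict_partials y.
  by apply: contrapT => nd; apply: ns.
have [r r0 rO] := open_normP Omega_open Oz.
pose V := [set y | `|z - y| < Num.min d r].
have oV : open V by exact: open_norm_ball.
have Vz : V z by rewrite /V /= subrr normr0 lt_min d0.
have VP y : V y -> exists A, strict_diff f y A.
  rewrite /V /= lt_min => /andP[/Hd yP _]; exact: strict_diff_of_partials yP.
split; last first.
  by have [A fA] := VP z Vz; have [_ ->] := strict_diff_differentiable fA.
move=> [_]; apply; exists V; split.
- by split.
- by move=> y; rewrite /V /= lt_min => /andP[_ /rO].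
- exact: strict_diff_C1.
Qed.

Variable x : 'rV[R]_n.

Definition ray (x' : 'rV[R]_n) (t : R) := x + t *: (x' - x).

(* By o-minimality: the segment [x, x'] has finitely many singular points. *)
Definition transverse : set 'rV[R]_n := [set x' | Omega x' /\
  ~ exists a b : R, [/\ 0 <= a, a < b, b <= 1 &
      forall t, a < t < b -> singular (ray x' t)]].

Lemma definable_ray_singular :
  definable D (fun p : 'rV[R]_n * R^o => singular (ray p.1 p.2)).
Proof.
(* [ray] is not affine in [x'] and [t] jointly, so its value is named [y] and described by
   coordinatewise products. *)
apply: (definable_ext (P := fun p : 'rV[R]_n * R^o => exists y : 'rV[R]_n,
  (forall i, (y - x) 0 i = (p.2 : R) * ((p.1 - x) 0 i)) /\ singular y)).
  move=> [x' t] /=; split=> [[y [yE Sy]]|S]; last first.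
    by exists (ray x' t); split=> // i; rewrite /ray addrC addKr [LHS]mxE.
  suff -> : ray x' t = y by [].
  by rewrite /ray -[RHS](subrK x) addrC; congr (_ + _); apply/rowP => i; rewrite yE mxE.
apply: (definable_ex hD); apply: (definable_and hD).
  apply: (definable_all_fin hD) => i.
  by apply: (definable_mul hD); affine.
have la : affine_map (fun q : 'rV[R]_n * R^o * 'rV[R]_n => q.2) by affine.
exact: (definable_comp hD la definable_singular).
Qed.

Lemma definable_transverse : D n transverse.
Proof.
apply/(proj2 (definable_rV hD _)).
apply: (definable_ext (P := fun x' => Omega x' /\ ~ exists a b : R^o,
  (0 <= (a : R) /\ (a : R) < (b : R)) /\ ((b : R) <= 1 /\
   forall t : R^o, ((a : R) < (t : R) /\ (t : R) < (b : R)) -> singular (ray x' t)))).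
  move=> x'; split=> -[Ox H]; split=> // -[a [b]].
    move=> [a0 ab b1 S]; apply: H; exists a, b; split=> //; split=> // t /andP; exact: S.
  move=> [[a0 ab] [b1 S]]; apply: H; exists a, b; split=> // t /andP; exact: S.
apply: (definable_and hD); first exact/(proj1 (definable_rV hD _)).
apply: (definable_not hD); apply: (definable_ex hD); apply: (definable_ex hD).
apply: (definable_and hD).
  by apply: (definable_and hD); [apply: (definable_le hD)|apply: (definable_lt hD)]; affine.
apply: (definable_and hD); first by apply: (definable_le hD); affine.
apply: (definable_all hD); apply: (definable_imply hD).
  by apply: (definable_and hD); apply: (definable_lt hD); affine.
have la : affine_map (fun q : 'rV[R]_n * R^o * R^o * R^o => (q.1.1.1, q.2)) by affine.
exact: (definable_comp hD la definable_ray_singular).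
Qed.

Lemma open_ray_preimage (U : set 'rV[R]_n) (t : R) :
  open U -> open [set x' | U (ray x' t)].
Proof.
move=> oU; rewrite openE => x' Ux'.
have [r r0 rU] := open_normP oU Ux'.
have t0 : 0 < `|t| + 1 by rewrite ltr_wpDl.
apply/nbhs_ballP; exists (r / (`|t| + 1)); first by rewrite /= divr_gt0.
move=> y; rewrite -ball_normE /= ltr_pdivlMr // => xy; apply: rU.
rewrite /ray opprD addrACA subrr add0r -scalerBr opprB addrA subrK normrZ.
by apply: le_lt_trans xy; rewrite mulrC ler_wpM2l // lerDl.
Qed.

Lemma transverse_dense : Omega `<=` closure transverse.
Proof.
move=> p Op U /nbhs_interior nU; apply: contrapT => UT.
pose W := U^° `&` Omega.
have oW : open W by apply: openI => //; exact: open_interior.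
have W0 : W !=set0 by exists p; split=> //; exact: nbhs_singleton nU.
pose A (q : rat) := [set x' | 0 < (ratr q : R) /\ singular (ray x' (ratr q))].
have WA : W `<=` \bigcup_q A q.
  move=> x' [/interior_subset Ux' Ox'].
  have [[a [b [a0 ab b1 S]]]|nab] := pselect (exists a b : R, [/\ 0 <= a, a < b, b <= 1 &
      forall t, a < t < b -> singular (ray x' t)]); last first.
    by exfalso; apply: UT; exists x'.
  have [q] := rat_in_itvoo ab; rewrite in_itv /= => qab.
  by exists q => //; split; [lra|exact: S].
have [q [V [oV [v Vv] VW VA]]] := baire_cover oW W0 WA.
have [z [Vz [q0 [Oz _]]]] := VA V oV (ex_intro _ v Vv) (@subset_refl _ _).
(* The homothety of centre [x] and ratio [q > 0] is a homeomorphism; it would carry the dense set of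
   [x'] to singular points dense in an open set, against [singular_nowhere_dense]. *)
pose ray_inv y := ray y (ratr q)^-1.
have rayK y : ray (ray_inv y) (ratr q) = y.
  by rewrite /ray_inv /ray addrAC subrr add0r scalerA divff ?gt_eqF // scale1r addrC subrK.
have rayK' y : ray_inv (ray y (ratr q)) = y.
  by rewrite /ray_inv /ray addrAC subrr add0r scalerA mulVf ?gt_eqF // scale1r addrC subrK.
have [|||U' [oU' [u U'u] U'V U'S]] :=
  @singular_nowhere_dense ([set y | V (ray_inv y)] `&` Omega).
- by apply: openI => //; exact: open_ray_preimage.
- by exists (ray z (ratr q)); rewrite /= rayK'.
- by move=> ? [].
have [|||y [[Vy U'y] [_ Sy]]] := VA (V `&` [set y | U' (ray y (ratr q))]).
- by apply: openI => //; exact: open_ray_preimage.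
- by exists (ray_inv u); rewrite /= rayK; have [] := U'V u U'u.
- by move=> ? [].
by have : (U' `&` singular) (ray y (ratr q)) by []; rewrite U'S.
Qed.

End SingularSet.

(** * Separation of a point from a closed convex set *)

Section Separation.
Variables (R : realType) (n : nat).
Implicit Types (K : set 'rV[R]_n) (p c : 'rV[R]_n).

(** The squared Euclidean distance; nearest points for the maximum norm would determine no normal
    direction. *)
Definition sqdist p c : R := \sum_i (p 0 i - c 0 i) ^+ 2.

Lemma continuous_sqdist p : continuous (sqdist p).
Proof.
move=> c; rewrite /continuous_at /sqdist; elim: (index_enum _) => [|i s IH].
  rewrite big_nil (_ : (fun k => _) = cst 0); first exact: cst_continuous.
  by apply: boolp.funext => k; rewrite big_nil.
rewrite big_cons (_ : (fun k => _) =
    (fun k : 'rV[R]_n => (p 0 i - k 0 i) * (p 0 i - k 0 i)) \+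
    (fun k => \sum_(j <- s) (p 0 j - k 0 j) ^+ 2)); last first.
  by apply: boolp.funext => k; rewrite big_cons /= expr2.
apply: cvgD IH; rewrite expr2.
have ci : p 0 i - k 0 i @[k --> c] --> p 0 i - c 0 i.
  apply: (@cvgB _ _ _ (nbhs c) _ (cst (p 0 i)) (fun k : 'rV[R]_n => k 0 i)).
    exact: cvg_cst.
  exact: coord_continuous.
exact: cvgM.
Qed.

Lemma norm_le_sqdist p c : `|p - c| <= sqdist p c + 1.
Proof.
have sq0 : 0 <= sqdist p c by apply: sumr_ge0 => i _; exact: sqr_ge0.
apply/rV_norm_leP; split=> [|i]; first by rewrite addr_ge0.
have : (p 0 i - c 0 i) ^+ 2 <= sqdist p c.
  by rewrite /sqdist (bigD1 i) //= lerDl sumr_ge0 // => j _; exact: sqr_ge0.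
by rewrite !mxE ler_norml => h; apply/andP; split; nra.
Qed.

(** By [norm_le_sqdist], every point of [K] at least as near to [p] as [k0] lies in the compact set
    [A], where a minimum is attained. *)
Lemma nearest_point K p : closed K -> K !=set0 ->
  exists2 c, K c & forall k, K k -> sqdist p c <= sqdist p k.
Proof.
move=> cK [k0 Kk0].
pose r := sqdist p k0 + 1.
pose A := K `&` [set k | `|p - k| <= r].
have k0A : A k0 by split=> //; exact: norm_le_sqdist.
have cA : closed A.
  apply: closedI => //.
  have cn : continuous (fun k => `|p - k|).
    move=> k; apply: (@cvg_norm _ _ _ (nbhs k) _ (fun k => p - k)).
    apply: (@cvgB _ _ _ (nbhs k) _ (cst p) id); [exact: cvg_cst|exact: cvg_id].
  rewrite -[X in closed X]/((fun k : 'rV[R]_n => `|p - k|) @^-1` [set t | t <= r]).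
  by apply: preimage_closed => [k _|]; [exact: cn|exact: closed_le].
have bA : bounded_set A.
  apply/(@ex_bound _ _ _ _ (globally A) (globally_properfilter k0A)).
  exists (`|p| + r) => k [_ /= pk].
  have -> : k = p - (p - k) by rewrite opprB addrCA subrr addr0.
  by apply: le_trans (ler_normB _ _) _; rewrite lerD2l.
have [c cAc cmin] := EVT_min_rV (ex_intro _ k0 k0A) (bounded_closed_compact bA cA)
  (continuous_subspaceT (@continuous_sqdist p)).
move: cAc; rewrite inE => -[Kc _]; exists c => // k Kk.
have [kA|kA] := pselect (A k); first by apply: cmin; rewrite inE.
apply: (@le_trans _ _ (sqdist p k0)); first by apply: cmin; rewrite inE.
have rk : r < `|p - k| by rewrite ltNge; apply/negP => h; apply: kA.
rewrite leNgt; apply/negP => kk0; have := norm_le_sqdist p k.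
by rewrite leNgt (lt_le_trans _ (ltW rk))// ltrD2r.
Qed.

(** The functional is the inner product with [p - c], where [c] is nearest to [p] in [K]; if some
    [k] in [K] exceeded its value at [c], moving from [c] towards [k] would come closer to [p]. *)
Lemma separation K p : closed K -> convex_set K -> K !=set0 -> ~ K p ->
  exists (w : 'cV[R]_n) (b : R),
    (forall k, K k -> (k *m w) 0 0 <= b) /\ b < (p *m w) 0 0.
Proof.
move=> cK xK K0 nKp; have [c Kc cmin] := nearest_point p cK K0.
pose w := (p - c)^T; exists w, ((c *m w) 0 0).
have dotE (h : 'rV[R]_n) : (h *m w) 0 0 = \sum_i h 0 i * (p 0 i - c 0 i).
  by rewrite mxE; apply: eq_bigr => i _; rewrite !mxE.
have sqE : ((p - c) *m w) 0 0 = sqdist p c.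
  by rewrite dotE; apply: eq_bigr => i _; rewrite !mxE expr2.
have subE (h k : 'rV[R]_n) : ((h - k) *m w) 0 0 = (h *m w) 0 0 - (k *m w) 0 0.
  by rewrite mulmxBl [LHS]mxE; congr (_ + _); rewrite [LHS]mxE.
split; last first.
  rewrite -subr_gt0 -subE sqE lt_neqAle sumr_ge0 ?andbT; last by move=> i _; exact: sqr_ge0.
  apply/eqP => /esym/psumr_eq0P pc; apply: nKp; suff -> : p = c by [].
  apply/rowP => i; apply/eqP; rewrite -subr_eq0 -sqrf_eq0; apply/eqP/pc => // j _.
  exact: sqr_ge0.
move=> k Kk; rewrite leNgt; apply/negP => ck.
(* The point at parameter H / (H + N) on [c, k] would be closer to p than c. *)
pose H := ((k - c) *m w) 0 0; pose N := sqdist k c.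
have H0 : 0 < H by rewrite /H subE subr_gt0.
have N0 : 0 <= N by apply: sumr_ge0 => i _; exact: sqr_ge0.
pose lam := H / (H + N).
have HN : 0 < H + N by rewrite ltr_wpDr.
have lam0 : 0 < lam by rewrite divr_gt0.
have lam1 : lam <= 1 by rewrite ler_pdivrMr // mul1r lerDl.
have Kl : K (lam *: k + (1 - lam) *: c).
  have := xK k c (Itv01 (ltW lam0) lam1); rewrite !inE => /(_ Kk Kc).
  by [].
have := cmin _ Kl; rewrite leNgt => /negP; apply.
have -> : sqdist p (lam *: k + (1 - lam) *: c) = sqdist p c - 2 * lam * H + lam ^+ 2 * N.
  rewrite /H dotE /N /sqdist !mulr_sumr -sumrB -big_split; apply: eq_bigr => i _ /=.
  by rewrite !mxE; ring.
(* Hence [lam ^+ 2 * N = lam * H - lam ^+ 2 * H], and the squared distance falls by at least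
   [lam * H]. *)
have lamE : lam * (H + N) = H by rewrite divfK // gt_eqF.
have : 0 < lam * H by rewrite mulr_gt0.
nra.
Qed.

End Separation.

(** * The scalar mean value inequality along the segment *)

Section MeanValue.
Variables (R : realType) (D : forall n, set (set 'rV[R]_n)).
Arguments D : clear implicits.
Hypothesis hD : o_minimal D.
Variables (n : nat) (Omega : set 'rV[R]_n) (f : 'rV[R]_n -> 'rV[R]_n).
Hypothesis Omega_open : open Omega.
Hypothesis Omega_def : D n Omega.
Hypothesis f_def : definable_map D Omega f.
Hypothesis f_cont : {within Omega, continuous f}.
Variables (x x' : 'rV[R]_n).
Hypothesis x'_transverse : transverse Omega f x x'.
Hypothesis segment_Omega : forall t, 0 <= t <= 1 -> Omega (ray x x' t).

Local Notation gamma := (ray x x').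

Lemma ray_sub s t : gamma s - gamma t = (s - t) *: (x' - x).
Proof. by rewrite /ray opprD addrACA subrr add0r -scalerBl. Qed.

(** By o-minimality the parameters just after [c] are all singular or all regular, and
    transversality excludes the former. *)
Lemma right_regular c : 0 <= c < 1 -> exists2 d, c < d <= 1 &
  forall t, c < t < d -> ~ singular Omega f (gamma t).
Proof.
move=> /andP[c0 c1].
have dS : definable D (fun t : R^o => singular Omega f (gamma t)).
  have la : affine_map (fun t : R^o => (x', t)) by affine.
  exact: (definable_comp hD la (definable_ray_singular hD Omega_def f_def x)).
have [d cd H] := definable_right_germ hD c dS.
exists (Num.min d 1); first by rewrite lt_min cd c1 ge_min lexx orbT.
case: H => H; last first.
  by move=> t; rewrite lt_min => /andP[ct /andP[td _]]; apply: H; rewrite ct.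
exfalso; case: x'_transverse => _; apply; exists c, (Num.min d 1); split=> //.
- by rewrite lt_min cd.
- by rewrite ge_min lexx orbT.
- by move=> t; rewrite lt_min => /andP[ct /andP[td _]]; apply: H; rewrite ct.
Qed.

Lemma functional_bound (w : 'cV[R]_n) :
  exists2 C, 0 <= C & forall v : 'rV[R]_n, `|(v *m w) 0 0| <= C * `|v|.
Proof.
exists (\sum_i `|w i 0|); first exact: sumr_ge0.
move=> v; rewrite mxE; apply: le_trans (ler_norm_sum _ _ _) _.
rewrite mulr_suml; apply: ler_sum => i _.
by rewrite normrM mulrC ler_wpM2l // le_rV_norm.
Qed.

(** At regular parameters [phi] has derivative at least [e], hence does not drop just after them; at
    a singular [c], continuity carries the inequality over from the regular parameters on its right.
    The slack [e] is arbitrary. *)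
Lemma functional_mean_value (w : 'cV[R]_n) (b : R) :
  (forall t, 0 <= t <= 1 -> ~ singular Omega f (gamma t) ->
     ((x' - x) *m 'J f (gamma t) *m w) 0 0 <= b) ->
  ((f x' - f x) *m w) 0 0 <= b.
Proof.
move=> Hb; apply/ler_addgt0Pr => e e0.
have [C C0 HC] := functional_bound w.
have C10 : 0 < C + 1 by rewrite ltr_wpDl.
have N10 : 0 < `|x' - x| + 1 by rewrite ltr_wpDl.
have subE (h k : 'rV[R]_n) : ((h - k) *m w) 0 0 = (h *m w) 0 0 - (k *m w) 0 0.
  by rewrite mulmxBl [LHS]mxE; congr (_ + _); rewrite [LHS]mxE.
pose phi t := (b + e) * t - (f (gamma t) *m w) 0 0.
have cphi c : 0 <= c <= 1 -> forall eta, 0 < eta -> exists2 d, 0 < d &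
    forall u, `|c - u| < d -> `|phi c - phi u| < eta.
  move=> c01 eta eta0.
  have fc : {for gamma c, continuous f}.
    move: f_cont; rewrite continuous_open_subspace //; apply.
    by rewrite inE; exact: segment_Omega.
  pose e1 := eta / (2 * (C + 1)).
  have e10 : 0 < e1 by rewrite divr_gt0 // mulr_gt0.
  have [r r0 Hr] : exists2 r : R, 0 < r &
      forall y, `|gamma c - y| < r -> `|f (gamma c) - f y| < e1.
    have /nbhs_ballP[r /= r0 Hr] := fc _ (nbhsx_ballx _ _ e10).
    exists r => // y cy; have := Hr y; rewrite -!ball_normE; exact.
  have B0 : 0 < `|b + e| + 1 by rewrite ltr_wpDl.
  exists (Num.min (r / (`|x' - x| + 1)) (eta / (2 * (`|b + e| + 1)))).
    by rewrite lt_min !divr_gt0 // mulr_gt0.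
  move=> u; rewrite lt_min !ltr_pdivlMr ?mulr_gt0 // => /andP[u1 u2].
  have fu : `|f (gamma c) - f (gamma u)| < e1.
    apply: Hr; rewrite ray_sub normrZ; apply: le_lt_trans u1.
    by rewrite ler_wpM2l // lerDl.
  have e1E : (C + 1) * e1 = eta / 2.
    by rewrite /e1; field; rewrite gt_eqF.
  have h1 := HC (f (gamma c) - f (gamma u)).
  have -> : phi c - phi u = (b + e) * (c - u) - ((f (gamma c) - f (gamma u)) *m w) 0 0.
    by rewrite subE /phi; ring.
  apply: le_lt_trans (ler_normB _ _) _; rewrite normrM.
  have : C * `|f (gamma c) - f (gamma u)| <= (C + 1) * e1.
    by apply: ler_pM => //; [rewrite lerDl|exact: ltW].
  have : `|b + e| * `|c - u| <= `|c - u| * (`|b + e| + 1).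
    by rewrite mulrC ler_wpM2l // lerDl.
  lra.
have regular_step c u : 0 <= c < u -> u <= 1 -> ~ singular Omega f (gamma c) ->
    exists2 d, c < d <= u & phi c <= phi d.
  move=> /andP[c0 cu] u1 ns.
  have c01 : 0 <= c <= 1 by lra.
  have [_ fJ] := regular_point Omega_open (segment_Omega c01) ns.
  (* The linearisation error, seen through [w], is then at most [e * s], which the slack
     compensates. *)
  pose e1 := e / ((C + 1) * (`|x' - x| + 1)).
  have e10 : 0 < e1 by rewrite divr_gt0 // mulr_gt0.
  have e1E : (C + 1) * (`|x' - x| + 1) * e1 = e.
    by rewrite /e1; field; rewrite !gt_eqF.
  have [d d0 Hd] := fJ _ e10.
  pose s := Num.min (u - c) (d / (2 * (`|x' - x| + 1))).
  have s0 : 0 < s by rewrite lt_min subr_gt0 cu divr_gt0 // mulr_gt0.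
  have su : s <= u - c by rewrite ge_min lexx.
  have sd : s * (2 * (`|x' - x| + 1)) <= d.
    by rewrite -ler_pdivlMr ?mulr_gt0 // ge_min lexx orbT.
  exists (c + s); first by apply/andP; split; lra.
  have stepE : gamma (c + s) - gamma c = s *: (x' - x).
    by rewrite ray_sub addrAC subrr add0r.
  have close : `|gamma c - gamma (c + s)| < d.
    rewrite distrC stepE normrZ gtr0_norm //.
    have := normr_ge0 (x' - x); nra.
  have := Hd (gamma c) (gamma (c + s)); rewrite subrr normr0 stepE => /(_ d0 close).
  rewrite -scalemxAl normrZ (gtr0_norm s0).
  set F := f (gamma (c + s)) - _; set G := (x' - x) *m _ => FG.
  have := le_trans (HC (F - s *: G)) (ler_wpM2l C0 FG).
  have Gb : (G *m w) 0 0 <= b by exact: Hb.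
  have sG : ((s *: G) *m w) 0 0 = s * (G *m w) 0 0 by rewrite -scalemxAl [LHS]mxE.
  rewrite subE sG ler_norml => /andP[_ FGw].
  have FwE : (F *m w) 0 0 = (f (gamma (c + s)) *m w) 0 0 - (f (gamma c) *m w) 0 0.
    by rewrite subE.
  have CN : C * `|x' - x| * e1 <= e.
    rewrite -[leRHS]e1E ler_wpM2r ?(ltW e10)// ler_pM // lerDl //.
  rewrite /phi; nra.
have phi01 : phi 0 <= phi 1.
  apply: le_by_right_steps => //.
    by move=> c c01 eta /(cphi c c01)[d d0 Hd]; exists d => // u _; exact: Hd.
  move=> c c01; have [d /andP[cd d1] Hd] := right_regular c01.
  (* As [m < d], all parameters in []c, m]] are regular. *)
  pose m := (c + d) / 2.
  have cm : c < m by rewrite /m; lra.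
  have md : m < d by rewrite /m; lra.
  exists m; first by apply/andP; split; lra.
  have Hu u : c < u < m -> phi u <= phi m.
    move=> cum; apply: le_by_right_steps; first by lra.
      move=> v vm eta /(cphi v)[|d' d'0 Hd']; first by lra.
      by exists d' => // u' _; exact: Hd'.
    by move=> v vm; apply: regular_step; [lra|lra|apply: Hd; lra].
  (* If [phi m < phi c], continuity at [c] gives a [u] just after [c] with [phi m < phi u], against
     [Hu]. *)
  rewrite leNgt; apply/negP => cm'.
  have [||d' d'0 Hd'] := cphi c _ (phi c - phi m); [lra|lra|].
  pose u := c + Num.min d' (m - c) / 2.
  have u0 : 0 < Num.min d' (m - c) by rewrite lt_min d'0 subr_gt0.
  have u1 : Num.min d' (m - c) <= d' by rewrite ge_min lexx.
  have u2 : Num.min d' (m - c) <= m - c by rewrite ge_min lexx orbT.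
  have : phi u <= phi m by apply: Hu; rewrite /u; lra.
  have : `|phi c - phi u| < phi c - phi m.
    by apply: Hd'; rewrite distrC ger0_norm /u; lra.
  by rewrite ltr_norml; lra.
have g0 : gamma 0 = x by rewrite /ray scale0r addr0.
have g1 : gamma 1 = x' by rewrite /ray scale1r addrC subrK.
by move: phi01; rewrite /phi g0 g1 subE; lra.
Qed.

End MeanValue.

(** * Conclusion by separating the increment from a closed convex set *)

Theorem theorem4p1 (R : realType) (D : forall n, set (set 'rV[R]_n))
    (hD : o_minimal D) (n : nat)
    (Omega : set 'rV[R]_n) (f : 'rV[R]_n -> 'rV[R]_n)
    (hOmega_open : open Omega) (hOmega_def : D n Omega)
    (hf_cont : {within Omega, continuous f})
    (hf_def : definable_map D Omega f)
    (x : 'rV[R]_n) (hx : Omega x) :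
  exists Omega_x : set 'rV[R]_n,
    [/\ Omega_x `<=` Omega, Omega `<=` closure Omega_x, D n Omega_x
      & forall x', Omega_x x' -> segment x x' `<=` Omega ->
          closed_convex_hull
            [set (x' - x) *m A | A in df_set Omega f (segment x x')]
            (f x' - f x)].
Proof.
exists (transverse Omega f x); split.
- by move=> x' [].
- by apply: (transverse_dense hD).
- exact: definable_transverse.
(* Membership in the hull is tested on each closed convex [C] containing the derivative vectors; one
   that missed [f x' - f x] could be separated from it. *)
move=> x' tx' seg C [[cC xC] SC]; apply: contrapT => nC.
have segE t : 0 <= t <= 1 -> segment x x' (ray x x' t).
  move=> t01; exists t => //; rewrite /ray scalerBr scalerBl scale1r.
  by rewrite addrA addrAC -addrA.
have segO t : 0 <= t <= 1 -> Omega (ray x x' t) by move=> /segE /seg.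
have JC t : 0 <= t <= 1 -> ~ singular Omega f (ray x x' t) ->
    C ((x' - x) *m 'J f (ray x x' t)).
  move=> t01 ns; apply: SC; exists ('J f (ray x x' t)) => //.
  exists (ray x x' t) => //; split; first exact: segE.
  by have [] := regular_point hOmega_open (segO t t01) ns.
(* Separation needs a point of [C]; a regular parameter just after 0 provides one. *)
have C0 : C !=set0.
  have [d /andP[d0 d1] Hd] := right_regular hD hOmega_def hf_def tx' (c := 0) ltac:(lra).
  by exists ((x' - x) *m 'J f (ray x x' (d / 2))); apply: JC; [lra|apply: Hd; lra].
have [w [b [wC]]] := separation cC xC C0 nC.
rewrite ltNge => /negP; apply.
apply: (functional_mean_value hD hOmega_open hOmega_def hf_def hf_cont tx' segO).
move=> t t01 ns.
exact/wC/JC.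
Qed.
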